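(* There exists a weakly complete complex surface $X^\ast$ such that (1) $X^\ast$ admits a real analytic plurisubharmonic exhaustion function and is a Grauert type surface; (2) $X^\ast$ admits a holomorphic involution $T:X^\ast\to X^\ast$ without fixed points; (3) the quotient $X=X^\ast/\langle T\rangle$ is again a Grauert type surface with a real analytic plurisubharmonic exhaustion function; (4) every proper pluriharmonic function $X\to\mathbb{R}$ is constant.
   Context: A complex surface is a complex manifold of complex dimension $2$. It is weakly complete if it admits a smooth plurisubharmonic exhaustion function, where an exhaustion function is a function all of whose sublevel sets $\{\alpha\le c\}$ are compact. A Grauert type surface is a connected non-compact complex manifold $X$ of complex dimension $2$ that admits a real analytic plurisubharmonic exhaustion function $\alpha:X\to\mathbb{R}$ such that the level sets of $\alpha$ at regular values are Levi-flat hypersurfaces foliated by dense complex leaves, i.e. every leaf of the Levi foliation is dense in the connected component of the level set containing it. $\langle T\rangle=\{I,T\}$ denotes the group generated by $T$, and a holomorphic involution is a holomorphic map $T$ with $T\circ T=\mathrm{id}$. *)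

(* Defs.v *)
From mathcomp Require Import all_boot all_order all_algebra.
From mathcomp Require Import complex.
From mathcomp Require Import all_classical all_reals all_analysis.
From Stdlib Require Import Relation_Operators.
Set Implicit Arguments.
Unset Strict Implicit.
Unset Printing Implicit Defensive.
Import Order.TTheory GRing.Theory Num.Theory.
Import numFieldNormedType.Exports.
Local Open Scope classical_set_scope.
Local Open Scope ring_scope.
Local Open Scope complex_scope.

(* C^n with the sup norm, as a normed space over C = R[i]; differentiability
   of maps between such spaces is therefore complex differentiability. *)
Definition Cn (R : realType) (n : nat) : normedModType R[i] := 'rV[R[i]]_n.

(* Calculus on C^n, z_j = x_j + i y_j. The real coordinates are indexed by
   'I_n * bool: (j, false) stands for x_j and (j, true) for y_j. *)
Section calculus.
Context {R : realType} {n : nat}.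
Implicit Types (u : Cn R n -> R) (U : set (Cn R n)) (z v h : Cn R n).

Definition rdir (i : 'I_n * bool) : Cn R n :=
  (if i.2 then 'i else 1) *: (delta_mx 0 i.1 : 'rV[R[i]]_n).

Definition rcoord (h : 'rV[R[i]]_n) (i : 'I_n * bool) : R :=
  if i.2 then complex.Im (h 0 i.1) else complex.Re (h 0 i.1).

Definition rline u z (i : 'I_n * bool) : R -> R :=
  fun t => u (z + t%:C *: rdir i).

Definition pd (i : 'I_n * bool) u : Cn R n -> R :=
  fun z => derive1 (rline u z i) 0.

Fixpoint Ck (k : nat) U u : Prop :=
  (forall z, U z -> {for z, continuous u}) /\
  match k with
  | 0 => True
  | l.+1 => forall i, (forall z, U z -> derivable (rline u z i) 0 1) /\
                      Ck l U (pd i u)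
  end.

(* u is the sum of an absolutely convergent power series in the 2n real
   coordinates on the polydisc of radius r around z; the N-th partial sum
   ranges over the multi-indices with all entries < N. *)
Definition real_analytic_at u z : Prop :=
  exists (a : {ffun 'I_n * bool -> nat} -> R) (r M : R),
    [/\ 0 < r,
     forall N : nat,
       \sum_(m : {ffun 'I_n * bool -> 'I_N})
          `|a [ffun i => m i : nat]| * r ^+ (\sum_i m i)%N <= M
     & forall h, (forall i, `|rcoord h i| < r) ->
       (fun N : nat => \sum_(m : {ffun 'I_n * bool -> 'I_N})
          a [ffun i => m i : nat] * \prod_i rcoord h i ^+ m i)
         @ \oo --> u (z + h)].

(* d u / d z_j = 1/2 (d/dx_j - i d/dy_j) u *)
Definition dz u z (j : 'I_n) : R[i] :=
  (2^-1 * pd (j, false) u z) -i* (2^-1 * pd (j, true) u z).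

(* d^2 u / (d z_j d conj(z_k))
     = 1/4 (d/dx_j - i d/dy_j) (d/dx_k + i d/dy_k) u *)
Definition dzdzbar u z (j k : 'I_n) : R[i] :=
  (4^-1 * (pd (j, false) (pd (k, false) u) z + pd (j, true) (pd (k, true) u) z))
  +i*
  (4^-1 * (pd (j, false) (pd (k, true) u) z - pd (j, true) (pd (k, false) u) z)).

Definition levi_form u z (v : 'rV[R[i]]_n) : R[i] :=
  \sum_(j < n) \sum_(k < n) dzdzbar u z j k * v 0 j * (v 0 k)^*.

End calculus.

Record chart (R : realType) (n : nat) (X : topologicalType) := Chart {
  chart_dom : set X;
  chart_map :> X -> Cn R n;
  chart_inv : Cn R n -> X;
  chart_dom_open : open chart_dom;
  chart_codom_open : open (chart_map @` chart_dom);
  chart_mapK : forall x, chart_dom x -> chart_inv (chart_map x) = x;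
  chart_continuous : forall x, chart_dom x -> {for x, continuous chart_map};
  chart_inv_continuous : forall z, (chart_map @` chart_dom) z ->
    {for z, continuous chart_inv}
}.

Definition chart_codom R n X (c : chart R n X) : set (Cn R n) :=
  c @` chart_dom c.

Record complex_manifold (R : realType) (n : nat) := ComplexManifold {
  carrier :> topologicalType;
  carrier_hausdorff : hausdorff_space carrier;
  carrier_second_countable : @second_countable carrier;
  atlas : set (chart R n carrier);
  atlas_cover : forall x, exists2 c, atlas c & chart_dom c x;
  atlas_holomorphic : forall c d x, atlas c -> atlas d ->
    chart_dom c x -> chart_dom d x ->
    differentiable (d \o chart_inv c) (c x)
}.

Notation complex_surface R := (complex_manifold R 2).

Section manifolds.
Context {R : realType} {n : nat} (X : complex_manifold R n).
Implicit Types (u : X -> R) (M : set X).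

Definition smooth u : Prop := forall c : chart R n X, atlas c ->
  forall k, Ck k (chart_codom c) (u \o chart_inv c).

Definition real_analytic u : Prop := forall (c : chart R n X) x, atlas c ->
  chart_dom c x -> real_analytic_at (u \o chart_inv c) (c x).

(* Meant for functions of class C^2. In R[i], 0 <= w says that w is a
   nonnegative real. *)
Definition plurisubharmonic u : Prop := forall (c : chart R n X) x, atlas c ->
  chart_dom c x -> forall v, 0 <= levi_form (u \o chart_inv c) (c x) v.

Definition pluriharmonic u : Prop := forall c : chart R n X, atlas c ->
  Ck 2 (chart_codom c) (u \o chart_inv c) /\
  forall x, chart_dom c x -> forall j k,
    dzdzbar (u \o chart_inv c) (c x) j k = 0.

Definition exhaustion u : Prop := forall a : R, compact [set x | u x <= a].

Definition proper_map u : Prop := forall K : set R, compact K -> compact (u @^-1` K).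

Definition level_set u (a : R) : set X := [set x | u x = a].

Definition regular_value u (a : R) : Prop :=
  forall (c : chart R n X) x, atlas c -> chart_dom c x -> level_set u a x ->
    exists i, pd i (u \o chart_inv c) (c x) != 0.

(* For a regular value a: the Levi form of the defining function u - a vanishes
   on the complex tangent spaces {v | sum_j (d u / d z_j) v_j = 0}. *)
Definition levi_flat_level u (a : R) : Prop :=
  forall (c : chart R n X) x, atlas c -> chart_dom c x -> level_set u a x ->
  forall v : 'rV[R[i]]_n,
    \sum_(j < n) dz (u \o chart_inv c) (c x) j * v 0 j = 0 ->
    levi_form (u \o chart_inv c) (c x) v = 0.

Definition unit_disc : set R[i]^o := [set z | `|z| < 1].

(* f restricts to a holomorphic immersion of the unit disc into X, with values
   in M. *)
Definition immersed_disc M (f : R[i]^o -> X) : Prop :=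
  forall z, unit_disc z ->
    [/\ {for z, continuous f}, M (f z)
      & forall c : chart R n X, atlas c -> chart_dom c (f z) ->
          derivable (c \o f) z 1 /\ 'D_1 (c \o f) z != 0].

Definition share_disc M (p q : X) : Prop :=
  exists f, [/\ immersed_disc M f, (f @` unit_disc) p & (f @` unit_disc) q].

(* When X is a surface and M is a Levi-flat hypersurface, the immersed complex
   curves contained in M are exactly the integral curves of the Levi
   distribution; the leaf of the Levi foliation through p is the union of the
   connected ones that contain p, i.e. what chains of holomorphic discs in M
   reach from p. *)
Definition leaf M (p : X) : set X :=
  [set q | clos_refl_trans X (share_disc M) p q].

Definition dense_leaves M : Prop :=
  forall p, M p -> connected_component M p `<=` closure (leaf M p).

Definition analytic_psh_exhaustion u : Prop :=
  [/\ real_analytic u, plurisubharmonic u & exhaustion u].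

End manifolds.

Section surfaces.
Context {R : realType}.

Definition weakly_complete (X : complex_surface R) : Prop :=
  exists u : X -> R, [/\ smooth u, plurisubharmonic u & exhaustion u].

Definition grauert_type (X : complex_surface R) : Prop :=
  [/\ connected [set: X], ~ compact [set: X] &
   exists2 u : X -> R, analytic_psh_exhaustion u &
     forall a, regular_value u a ->
       levi_flat_level u a /\ dense_leaves (level_set u a)].

End surfaces.

Section holomorphic_maps.
Context {R : realType} {n m : nat}.
Context (X : complex_manifold R n) (Y : complex_manifold R m).

Definition holomorphic_on (U : set X) (f : X -> Y) : Prop := forall x, U x ->
  {for x, continuous f} /\
  forall (c : chart R n X) (d : chart R m Y), atlas c -> atlas d ->
    chart_dom c x -> chart_dom d (f x) ->
    differentiable (d \o f \o chart_inv c) (c x).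

End holomorphic_maps.

Section quotients.
Context {R : realType} {n : nat}.

Definition local_biholomorphism (X Y : complex_manifold R n) (f : X -> Y) :=
  forall x, exists (U : set X) (g : Y -> X),
    [/\ open U /\ U x, open (f @` U), forall y, U y -> g (f y) = y,
        holomorphic_on U f & holomorphic_on (f @` U) g].

Definition holomorphic_involution (X : complex_manifold R n) (T : X -> X) :=
  holomorphic_on [set: X] T /\ forall x, T (T x) = x.

(* q : X -> Y is the quotient map onto Y = X / {id, T}: its fibres are the
   T-orbits, and the complex structure of Y is the only one for which q is a
   local biholomorphism. *)
Definition is_quotient_by (X : complex_manifold R n) (T : X -> X)
    (Y : complex_manifold R n) (q : X -> Y) : Prop :=
  [/\ forall y, exists x, q x = y,
      forall x x', q x = q x' <-> (x' = x \/ x' = T x)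
    & local_biholomorphism q].

End quotients.

(* Main.v *)
(* Let chi(a) = exp(i a). The group generated by (z, v) |-> (z + d, chi(d) v) and
   (z, v) |-> (z + i, v) acts freely on C^2 for every integer d > 0; its quotient
   X_d is the total space of a flat unitary line bundle over an elliptic curve, and
   |v|^2 descends to a real analytic plurisubharmonic exhaustion function. Its
   positive level sets are foliated by the images of the lines v = const; the
   holonomy is generated by chi(d), a rotation by an irrational multiple of 2 pi
   since pi is irrational, so every leaf is dense.
   Take X^* = X_2 and X = X_1, with T induced by (z, v) |-> (z + 1, chi(1) v).

   If u is a proper pluriharmonic function on X, then |u| > |u(0, 0)| + 1 on a level
   set |v|^2 = c. This level set is connected, so u has a constant sign there; up to
   replacing u by -u it is positive. Then u - |v|^2 / c attains its minimum over
   |v|^2 <= c at an interior point, which is impossible because its Laplacian in v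
   is negative. *)
Require Import Defs.
From mathcomp Require Import all_boot all_order all_algebra.
From mathcomp Require Import generic_quotient complex ring lra.
From mathcomp Require Import all_classical all_reals all_analysis.
From Stdlib Require Import Relation_Operators.
Set Implicit Arguments.
Unset Strict Implicit.
Unset Printing Implicit Defensive.
Import Order.TTheory GRing.Theory Num.Theory.
Import numFieldNormedType.Exports.
Local Open Scope classical_set_scope.
Local Open Scope ring_scope.
Local Open Scope complex_scope.

(** * Irrational rotations *)

Section circle.
Context {R : realType}.
Implicit Types (x t eps : R).

Lemma irrational_eq0 x (k m : int) : ~ rational x ->
  k%:~R * x + m%:~R = 0 -> k = 0.
Proof.
move=> irr kxm; apply/eqP; apply: contra_notT irr => k0.
have k0' : k%:~R != 0 :> R by rewrite intr_eq0.
exists (- m%:~R / k%:~R) => //.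
rewrite fmorph_div rmorphN !rmorph_int; apply: (mulIf k0').
by rewrite divfK// [RHS]mulrC; apply/eqP; rewrite eq_sym -subr_eq0 opprK kxm.
Qed.

Lemma irrational_multiple_near_int x eps : ~ rational x -> 0 < eps ->
  exists k m : int, 0 < k%:~R * x + m%:~R < eps.
Proof.
move=> irr eps0.
pose N := (Num.truncn eps^-1).+1.
have N0 : 0 < N%:R :> R by rewrite ltr0n.
have Neps : N%:R^-1 < eps.
  by rewrite -[eps]invrK ltf_pV2 ?posrE ?invr_gt0// truncnS_gt.
pose fr (k : nat) : R := k%:R * x - (Num.floor (k%:R * x))%:~R.
have frP k : 0 <= fr k < 1.
  by have /andP[] := floor_itv (k%:R * x); rewrite /fr intrD => *; apply/andP; split; lra.
have box_lt k : (Num.truncn (N%:R * fr k) < N)%N.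
  have /andP[f0 f1] := frP k.
  by rewrite truncn_lt_nat ?mulr_ge0 ?ler0n// -[ltRHS]mulr1 ltr_pM2l.
(* Pigeonhole on the fractional parts of the multiples of [x]. *)
pose box (k : 'I_N.+1) := Ordinal (box_lt k).
have [/injectiveP/leq_card|/injectivePn[j [k jk /(congr1 val)/= jkbox]]] :=
  boolP (injectiveb box); first by rewrite !card_ord ltnn.
have close (i l : 'I_N.+1) : Num.truncn (N%:R * fr i) = Num.truncn (N%:R * fr l) ->
    fr i - fr l < N%:R^-1.
  have /andP[i0 _] := frP i; have /andP[l0 _] := frP l.
  have /andP[_ ] := truncn_itv (mulr_ge0 (ltW N0) i0).
  have /andP[+ _] := truncn_itv (mulr_ge0 (ltW N0) l0).
  move=> + + il; rewrite il -natr1 => h1 h2.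
  by rewrite -(ltr_pM2l N0) mulfV ?gt_eqF// mulrBr; lra.
wlog ltjk : j k jk jkbox / fr k < fr j => [hw|].
  case: (ltgtP (fr k) (fr j)) => [|fjk|fjk]; first exact: hw.
    by apply: (hw k j) => //; rewrite eq_sym.
  (* Equal fractional parts of two distinct multiples would make a nonzero integer multiple of [x]
     an integer, against irrationality. *)
  exfalso; move: jk => /eqP; apply; apply: val_inj => /=.
  have : ((j : nat)%:Z - (k : nat)%:Z)%:~R * x +
      (Num.floor (k%:R * x) - Num.floor (j%:R * x))%:~R = 0.
    by move: fjk; rewrite /fr !intrB -!pmulrn mulrBl; lra.
  by move/(irrational_eq0 irr)/eqP; rewrite subr_eq0 => /eqP[].
exists ((j : nat)%:Z - (k : nat)%:Z),
  (Num.floor (k%:R * x) - Num.floor (j%:R * x)).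
have -> : ((j : nat)%:Z - (k : nat)%:Z)%:~R * x +
    (Num.floor (k%:R * x) - Num.floor (j%:R * x))%:~R = fr j - fr k.
  by rewrite /fr !intrB -!pmulrn mulrBl; lra.
by rewrite subr_gt0 ltjk (lt_trans _ Neps)// close.
Qed.

(** A combination [y] in ]0, eps[ has integer multiples at spacing less than [eps]; the last one not
    exceeding [t] is close enough. *)
Lemma irrational_multiples_dense x t eps : ~ rational x -> 0 < eps ->
  exists k m : int, `|k%:~R * x + m%:~R - t| < eps.
Proof.
move=> irr eps0.
have [k [m /andP[]]] := irrational_multiple_near_int irr eps0.
set y := (_ + _) => y0 yeps.
exists (Num.floor (t / y) * k), (Num.floor (t / y) * m).
have -> : (Num.floor (t / y) * k)%:~R * x + (Num.floor (t / y) * m)%:~R =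
    (Num.floor (t / y))%:~R * y by rewrite /y !intrM; ring.
have /andP[] := floor_itv (t / y).
rewrite ler_pdivlMr// ltr_pdivrMr// intrD mulrDl mul1r => h1 h2.
by rewrite ltr_norml; apply/andP; split; lra.
Qed.

(** This is exp(it), the character chi of the overview. *)
Definition cis t : R[i] := cos t +i* sin t.

Lemma cisD s t : cis (s + t) = cis s * cis t.
Proof.
by rewrite /cis cosD sinD; apply/eqP; rewrite eq_complex/= eqxx; apply/eqP; ring.
Qed.

Lemma cis0 : cis 0 = 1.
Proof. by rewrite /cis cos0 sin0. Qed.

Lemma cisD2pi t (m : int) : cis (t + m%:~R * (pi *+ 2)) = cis t.
Proof.
have cisn (n : nat) s : cis (s + n%:R * (pi *+ 2)) = cis s.
  elim: n s => [|n IH] s; first by rewrite mul0r addr0.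
  rewrite -natr1 mulrDl mul1r addrA /cis cosD2pi sinD2pi; exact: IH.
case: m => n; first exact: cisn.
by rewrite -[in RHS](subrK (n.+1%:R * (pi *+ 2)) t) cisn NegzE mulrNz mulNr.
Qed.

Lemma norm_cis t : `|cis t| = 1.
Proof. by rewrite normc_def/= cos2Dsin2 sqrtr1. Qed.

Lemma cis_onto (z : R[i]) : `|z| = 1 -> exists t, z = cis t.
Proof.
case: z => x y; rewrite normc_def/= => /complexI xy1.
have xy : x ^+ 2 + y ^+ 2 = 1.
  by rewrite -[LHS]sqr_sqrtr ?addr_ge0 ?sqr_ge0// xy1 expr1n.
have x1 : -1 <= x <= 1.
  rewrite -ler_norml -(@ler_pXn2r _ 2)// ?nnegrE// expr1n real_normK ?num_real//.
  by rewrite -xy lerDl sqr_ge0.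
have y2 : y ^+ 2 = 1 - x ^+ 2 by lra.
have cx : cos (acos x) = x by rewrite acosK// in_itv.
have [y0|/ltW y0] := leP 0 y; [exists (acos x)|exists (- acos x)];
  rewrite /cis ?cosN ?sinN cx sin_acos// -y2 sqrtr_sqr.
  by rewrite ger0_norm.
by rewrite ler0_norm// opprK.
Qed.

End circle.

(** * Topology of the complex plane and of C^2 *)

(** The differential of [f] also serves for [g], since the two remainders agree near [x]. This lets
    maps be differentiated that follow a formula only locally. *)
Lemma near_eq_differentiable (K : numFieldType) (V W : normedModType K)
    (f g : V -> W) (x : V) :
  (\near x, f x = g x) -> differentiable f x -> differentiable g x.
Proof.
move=> fg df.
have dg : g = cst (g (lim (nbhs x))) + 'd f x \o center (lim (nbhs x)) +o_x (center (lim (nbhs x))).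
  case: (df) => -[_ /eqaddoP fo]; apply/eqaddoP => e e0.
  have fgx : f x = g x := nbhs_singleton fg.
  rewrite lim_id// in fo *.
  apply: filterS2 fg (fo e e0) => y fgy.
  by rewrite !fctE /= fgx fgy.
have : exists df0 : {linear V -> W}, continuous df0 /\ forall y,
    g y = g (lim (nbhs x)) + df0 (y - lim (nbhs x)) +o_(y \near x) (y - lim (nbhs x)).
  by exists ('d f x); split=> [|y]; [exact: diff_continuous|rewrite [in LHS]dg].
by move=> /getPex dg'; apply/diffP.
Qed.

Section complex_topology.
Context {R : realType}.
Local Notation C := (R[i]^o).

Lemma continuous_real_complex : continuous (fun x : R => (x%:C : C)).
Proof.
move=> x; apply/cvgrPdist_lt => /= e e0.
(* A positive element of [R[i]] is real, so the estimate can be made in [R]. *)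
have eE : e = (complex.Re e)%:C by rewrite RRe_real// gtr0_real.
have e0' : 0 < complex.Re e by rewrite -ltcR -eE.
near=> t.
rewrite eE -rmorphB normc_def/= expr0n addr0 sqrtr_sqr ltcR.
near: t.
exact: (@cvgr_dist_lt _ _ _ (nbhs x) _ id x cvg_id).
Unshelve. all: by end_near. Qed.

Lemma continuous_Re : continuous (fun z : C => complex.Re z).
Proof.
move=> z; apply/(@cvgrPdist_lt _ _ _ _ (nbhs_filter (z : C))) => e e0.
have e0' : 0 < e%:C by rewrite ltcR.
apply/nbhs_ballP; exists e%:C => //= w zw.
rewrite -ltcR; apply: le_lt_trans zw.
by case: z w => [x y] [x' y']; exact: (normc_ge_Re ((x +i* y) - (x' +i* y'))).
Qed.

Lemma continuous_Im : continuous (fun z : C => complex.Im z).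
Proof.
have -> : (fun z : C => complex.Im z) = (fun z : C => complex.Re (- 'i * z : C)).
  by apply/funext => -[x y] /=; rewrite oppr0 mul0r; ring.
move=> z; apply: continuous_comp; last exact: continuous_Re.
exact: (@mulrl_continuous _ (- 'i)).
Qed.

Lemma continuous_complex (T : topologicalType) (f g : T -> R) :
  continuous f -> continuous g -> continuous (fun t => f t +i* g t : C).
Proof.
move=> cf cg t.
have -> : (fun t => f t +i* g t) = (fun t => (f t)%:C + 'i * (g t)%:C : C).
  by apply/funext => s; rewrite [LHS]complexE.
apply: cvgD; first by apply: continuous_comp; [exact: cf|exact: continuous_real_complex].
apply: cvgM; first exact: cvg_cst.
by apply: continuous_comp; [exact: cg|exact: continuous_real_complex].
Qed.

Lemma continuous_cis : continuous (cis : R -> C).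
Proof. exact: continuous_complex (@continuous_cos R) (@continuous_sin R). Qed.

End complex_topology.

Lemma continuous_rcoord (R : realType) n (i : 'I_n * bool) :
  continuous (fun w : Cn R n => rcoord w i).
Proof.
case: i => j []; have cj : continuous (fun w : Cn R n => (w : 'rV_n) 0 j : R[i]^o).
- exact: coord_continuous.
- by move=> w; exact: (continuous_comp (cj w) (@continuous_Im R _)).
- exact: coord_continuous.
- by move=> w; exact: (continuous_comp (cj w) (@continuous_Re R _)).
Qed.

Lemma ord2P (j : 'I_2) : j = 0 \/ j = 1.
Proof. by case: j => [[|[|//]]] ?; [left|right]; exact: val_inj. Qed.

Section C2.
Context {R : realType}.
Local Notation C := (R[i]^o).
Implicit Types (w : Cn R 2) (a b : R[i]).

Definition vec a b : Cn R 2 := a *: delta_mx 0 0 + b *: delta_mx 0 1.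
Definition fst_co w : R[i] := (w : 'rV_2) 0 0.
Definition snd_co w : R[i] := (w : 'rV_2) 0 1.

Lemma fst_vec a b : fst_co (vec a b) = a.
Proof. by rewrite /fst_co /vec !mxE/= mulr1 mulr0 addr0. Qed.

Lemma snd_vec a b : snd_co (vec a b) = b.
Proof. by rewrite /snd_co /vec !mxE/= mulr1 mulr0 add0r. Qed.

Lemma vec_eta w : vec (fst_co w) (snd_co w) = w.
Proof.
apply/rowP => j.
have [->|->] := ord2P j.
  exact: fst_vec.
exact: snd_vec.
Qed.

Lemma eq_vec w w' : fst_co w = fst_co w' -> snd_co w = snd_co w' -> w = w'.
Proof. by rewrite -[w]vec_eta -[w']vec_eta !fst_vec !snd_vec => -> ->. Qed.

Lemma continuous_vec (T : topologicalType) (f g : T -> C) :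
  continuous f -> continuous g -> continuous (fun t => vec (f t) (g t)).
Proof.
move=> cf cg t; apply: (@cvgD _ (Cn R 2)).
  exact: (@cvgZr_tmp _ (Cn R 2)) (cf t).
exact: (@cvgZr_tmp _ (Cn R 2)) (cg t).
Qed.

Lemma differentiable_affine a b c d w :
  differentiable (fun w => vec (a * fst_co w + b) (c * snd_co w + d) : Cn R 2) w.
Proof.
apply: differentiableD; apply: (@differentiableZl _ (Cn R 2) (Cn R 2));
  apply: differentiableD => //; apply: differentiableM => //; exact: differentiable_coord.
Qed.

End C2.

(** * The quotient of C^2 *)

Section action.
Local Open Scope quotient_scope.
Context {R : realType}.
Implicit Types (a b d : int) (w p : Cn R 2).

(** The action of the whole of Z^2, twisting the fibre by chi(a). It is shared by all the quotients,
    so that coverings between them are also induced by [act]. *)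
Definition act a b w : Cn R 2 :=
  vec (fst_co w + (a%:~R +i* b%:~R)) (cis a%:~R * snd_co w).

Lemma act0 w : act 0 0 w = w.
Proof. by apply: eq_vec; rewrite ?fst_vec ?snd_vec ?addr0// cis0 mul1r. Qed.

Lemma actA a b a' b' w : act a b (act a' b' w) = act (a + a') (b + b') w.
Proof.
apply: eq_vec; rewrite ?fst_vec ?snd_vec.
  by rewrite -addrA; congr (_ + _); rewrite !intrD addrC.
by rewrite intrD cisD mulrA.
Qed.

Lemma actK a b w : act (- a) (- b) (act a b w) = w.
Proof. by rewrite actA !addNr act0. Qed.

Lemma differentiable_act a b w : differentiable (act a b) w.
Proof.
have -> : act a b = fun w => vec (1 * fst_co w + (a%:~R +i* b%:~R)) (cis a%:~R * snd_co w + 0).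
  by apply/funext => w'; rewrite mul1r addr0.
exact: differentiable_affine.
Qed.

Lemma continuous_act a b : continuous (act a b).
Proof. by move=> w; apply: differentiable_continuous; exact: differentiable_act. Qed.

(** The acting group is dZ x Z; the relation is made boolean to form a quotient type. *)
Definition orbit_rel d w w' := `[< exists a b, (d %| a)%Z /\ w' = act a b w >].

Lemma orbit_rel_equiv d : equiv_class_of (orbit_rel d).
Proof.
split.
- by move=> w; apply/asboolP; exists 0, 0; rewrite act0 dvdz0.
- move=> w w'; apply/asbool_equiv_eq; split=> -[a [b [da ->]]]; exists (- a), (- b);
  by rewrite rpredN actK.
- move=> w w' w'' /asboolP[a [b [da ->]]] /asboolP[a' [b' [da' ->]]].
  apply/asboolP; exists (a' + a), (b' + b); split; first exact: rpredD.
  by rewrite actA.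
Qed.

Canonical orbit_equiv_rel d := EquivRelPack (orbit_rel_equiv d).

Definition quot d : topologicalType := quotient_topology {eq_quot (orbit_rel d)}.

Definition quot_proj d (w : Cn R 2) : quot d := \pi_({eq_quot (orbit_rel d)}) w.

Lemma quot_proj_onto d (x : quot d) : exists w, quot_proj d w = x.
Proof. by exists (repr x); rewrite /quot_proj reprK. Qed.

Lemma quot_projP d w w' :
  quot_proj d w = quot_proj d w' <-> exists a b, (d %| a)%Z /\ w' = act a b w.
Proof.
split=> [/eqmodP/asboolP//|h].
by apply/eqmodP/asboolP.
Qed.

Lemma open_quot d (U : set (quot d)) : open U <-> open (quot_proj d @^-1` U).
Proof. by []. Qed.

Lemma continuous_quot_proj d : continuous (quot_proj d).
Proof. exact: pi_continuous. Qed.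

Lemma continuous_quot d (T : topologicalType) (f : quot d -> T) :
  continuous (f \o quot_proj d) -> continuous f.
Proof. by move=> cf; apply/quotient_continuous. Qed.

(** The saturation of [A] is a union of preimages of [A] under the homeomorphisms [act a b]. *)
Lemma open_quot_proj d (A : set (Cn R 2)) : open A -> open (quot_proj d @` A).
Proof.
move=> oA; apply/open_quot.
have -> : quot_proj d @^-1` (quot_proj d @` A) =
    \bigcup_(ab in [set ab : int * int | (d %| ab.1)%Z]) (act ab.1 ab.2 @^-1` A).
  apply/seteqP; split=> w /=.
    by move=> [w' Aw' /esym/quot_projP[a [b [da ww']]]]; exists (a, b) => //=; rewrite -ww'.
  by move=> [[a b] /= da Aw]; exists (act a b w) => //; apply/esym/quot_projP; exists a, b.
apply: bigcup_open => ab _; apply: open_comp => // w _; exact: continuous_act.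
Qed.

End action.

(** * The complex structure of the quotient *)

Section manifold_structure.
Context {R : realType} (d : int).
Implicit Types (e : R) (a b : int) (w p : Cn R 2).

Lemma open_norm_lt (T : topologicalType) (f : T -> R) (c e : R) :
  continuous f -> open [set t | `|f t - c| < e].
Proof.
move=> cf; have -> : [set t | `|f t - c| < e] = f @^-1` ball c e.
  by apply/seteqP; split=> t /=; rewrite /ball/= distrC.
by apply: open_comp; [move=> t _; exact: cf|exact: ball_open].
Qed.

(** Only the base coordinate is restricted, to an open square of half-side [e]; the fibre is kept
    whole. For [e] = 1/2 the projection is injective on it. *)
Definition strip e p : set (Cn R 2) := [set w |
  `|complex.Re (fst_co w) - complex.Re (fst_co p)| < e /\
  `|complex.Im (fst_co w) - complex.Im (fst_co p)| < e].

Lemma strip_center e p : 0 < e -> strip e p p.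
Proof. by move=> e0; split; rewrite subrr normr0. Qed.

Lemma open_strip e p : open (strip e p).
Proof.
apply: openI; apply: open_norm_lt.
  exact: (@continuous_rcoord R 2 (0, false)).
exact: (@continuous_rcoord R 2 (0, true)).
Qed.

Lemma norm_int_lt1 a : `|a%:~R : R| < 1 -> a = 0.
Proof.
by rewrite -intr_norm (ltr_int _ _ 1) -[1]add0r ltzD1 normr_le0 => /eqP.
Qed.

Lemma strip_act p w a b : strip 2^-1 p w -> strip 2^-1 p (act a b w) -> a = 0 /\ b = 0.
Proof.
rewrite /strip/= fst_vec; case: (fst_co w) => x y /= [h1 h2] [h3 h4].
by split; apply: norm_int_lt1; move: h1 h2 h3 h4;
  rewrite !ltr_norml => /andP[? ?] /andP[? ?] /andP[? ?] /andP[? ?]; apply/andP; split; lra.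
Qed.

(** The inverse of the projection on the strip around [p], used as the chart map; [p] is the default
    value outside the chart domain. *)
Definition section p (x : quot d) : Cn R 2 :=
  xget p [set w | strip 2^-1 p w /\ quot_proj d w = x].

Lemma section_proj p w : strip 2^-1 p w -> section p (quot_proj d w) = w.
Proof.
move=> pw.
have [] : [set v | strip 2^-1 p v /\ quot_proj d v = quot_proj d w] (section p (quot_proj d w)).
  by apply: xgetPex; exists w.
move: (section _ _) => v pv /quot_projP[a [b [_ wE]]].
have [a0 b0] : a = 0 /\ b = 0 by apply: (strip_act pv); rewrite -wE.
by rewrite wE a0 b0 act0.
Qed.

(** The element (a, b) that moves [w] into the open strip does the same for all points near [w]. So
    in charts every map built from projections and sections is locally one [act a b], hence
    holomorphic. *)
Lemma section_near p w : (quot_proj d @` strip 2^-1 p) (quot_proj d w) ->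
  exists a b, [/\ (d %| a)%Z, strip 2^-1 p (act a b w) &
    \forall v \near w, section p (quot_proj d v) = act a b v].
Proof.
move=> [w' pw' /esym/quot_projP[a [b [da wE]]]].
exists a, b; split=> //; first by rewrite -wE.
have : nbhs (act a b w) (strip 2^-1 p).
  by move: (@open_strip 2^-1 p); rewrite openE -wE; apply.
move=> /(@continuous_act _ a b w) pw.
apply: (@filterS _ (nbhs w) (nbhs_filter w) _ _ _ pw) => v pv.
rewrite -(section_proj pv); congr section.
by apply/quot_projP; exists a, b.
Qed.

Lemma proj_section p x : (quot_proj d @` strip 2^-1 p) x -> quot_proj d (section p x) = x.
Proof. by move=> [w pw <-]; rewrite section_proj. Qed.

Lemma section_image p : section p @` (quot_proj d @` strip 2^-1 p) = strip 2^-1 p.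
Proof.
apply/seteqP; split=> [_ [_ [w pw <-] <-]|w pw]; first by rewrite section_proj.
by exists (quot_proj d w); [exists w|rewrite section_proj].
Qed.

Lemma continuous_section p x : (quot_proj d @` strip 2^-1 p) x -> {for x, continuous (section p)}.
Proof.
move=> [w pw <-]; rewrite /prop_for/continuous_at (section_proj pw) => V.
rewrite nbhsE => -[U [oU Uw] UV].
apply: filterS (open_nbhs_nbhs (conj (open_quot_proj (openI oU (@open_strip 2^-1 p))) _)).
  by move=> _ [v [Uv pv] <-]; apply: UV; rewrite section_proj.
by exists w.
Qed.

(** The chart inverse is the projection on all of C^2, so composing a function with it gives the
    same lift to C^2 for every chart. *)
Program Definition quot_chart p : chart R 2 (quot d) :=
  @Chart R 2 (quot d) (quot_proj d @` strip 2^-1 p) (section p) (quot_proj d) _ _ _ _ _.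
Next Obligation. by move=> p; exact/open_quot_proj/open_strip. Qed.
Next Obligation. by move=> p; rewrite section_image; exact: open_strip. Qed.
Next Obligation. by move=> p x; exact: proj_section. Qed.
Next Obligation. by move=> p x; exact: continuous_section. Qed.
Next Obligation. by move=> p w _; exact: continuous_quot_proj. Qed.

Definition quot_atlas : set (chart R 2 (quot d)) := range quot_chart.

Lemma differentiable_section_proj p w : (quot_proj d @` strip 2^-1 p) (quot_proj d w) ->
  differentiable (section p \o quot_proj d) w.
Proof.
move=> /section_near[a [b [_ _ sE]]].
apply: near_eq_differentiable (differentiable_act a b w).
by apply: filterS sE.
Qed.

End manifold_structure.

(** * Separation, countability and the resulting complex surface *)

Section surface.
Context {R : realType} (d : int).
Implicit Types (a b : int) (w p q : Cn R 2).

(** With half-side 1/4 both a and a' lie within 1/2 of the real part of q - p in the base, so they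
    differ by less than 1; likewise for b and b'. *)
Lemma strip4_act p q w w' a b a' b' : strip 4^-1 p w -> strip 4^-1 q (act a b w) ->
  strip 4^-1 p w' -> strip 4^-1 q (act a' b' w') -> a = a' /\ b = b'.
Proof.
rewrite /strip/= !fst_vec; case: (fst_co w) (fst_co w') => x y [x' y'] /=.
move=> [h1 h2] [h3 h4] [h5 h6] [h7 h8].
by split; apply/eqP; rewrite -subr_eq0; apply/eqP/(@norm_int_lt1 R); rewrite intrB;
  move: h1 h2 h3 h4 h5 h6 h7 h8; rewrite !ltr_norml => /andP[? ?] /andP[? ?]
    /andP[? ?] /andP[? ?] /andP[? ?] /andP[? ?] /andP[? ?] /andP[? ?];
  apply/andP; split; lra.
Qed.

Lemma strip_nbhs e p : 0 < e -> nbhs p (strip e p).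
Proof. by move=> e0; move: (@open_strip _ e p); rewrite openE; apply; exact: strip_center. Qed.

Lemma quot_proj_nbhs p (A : set (Cn R 2)) :
  nbhs p A -> nbhs (quot_proj d p) (quot_proj d @` A).
Proof.
rewrite (nbhsE p) => -[U [oU Up] UA].
apply: filterS (open_nbhs_nbhs (conj (open_quot_proj oU) _)).
  exact: image_subset.
by exists p.
Qed.

(** If the classes of [p] and [q] cannot be separated, points arbitrarily close to [p] are moved
    close to [q] by group elements. Inside strips of half-side 1/4 this element is always the same
    (a, b), so [act a b p] and [q] cannot be separated in C^2 and are equal. *)
Lemma quot_hausdorff : hausdorff_space (@quot R d).
Proof.
move=> x y; have [p <-] := quot_proj_onto x; have [q <-] := quot_proj_onto y => pq.
have meet (A B : set (Cn R 2)) : nbhs p A -> nbhs q B ->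
    exists w a b, [/\ (d %| a)%Z, A w & B (act a b w)].
  move=> /quot_proj_nbhs pA /quot_proj_nbhs qB.
  have [_ [[w Aw <-] [w' Bw' /esym/quot_projP[a [b [da wE]]]]]] := pq _ _ pA qB.
  by exists w, a, b; rewrite -wE.
have s4 (v : Cn R 2) : nbhs v (strip 4^-1 v) by apply: strip_nbhs; rewrite invr_gt0 ltr0n.
have [w0 [a [b [da pw0 qw0]]]] := meet _ _ (s4 p) (s4 q).
apply/quot_projP; exists a, b; split=> //; apply/esym.
apply: (@norm_hausdorff _ (Cn R 2)) => A B.
move=> pA Bq; have Ap : nbhs p (act a b @^-1` A) by exact: continuous_act.
have [w [a' [b' [_ [Aw pw] [Bw qw]]]]] := meet _ _ (filterI Ap (s4 p)) (filterI Bq (s4 q)).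
have [aa' bb'] := strip4_act pw0 qw0 pw qw; exists (act a b w).
by split=> //; rewrite aa' bb'.
Qed.

Lemma normc_le_ReIm (z : R[i]) : `|z| <= (`|complex.Re z| + `|complex.Im z|)%:C.
Proof.
case: z => x y; rewrite normc_def/= lecR -[leRHS]ger0_norm ?addr_ge0//.
rewrite -sqrtr_sqr ler_wsqrtr// sqrrD !real_normK ?num_real//.
by rewrite lerD2r lerDl mulrn_wge0// mulr_ge0.
Qed.

Lemma nbhs_rcoord p (A : set (Cn R 2)) : nbhs p A ->
  exists2 e : R, 0 < e & forall w, (forall i, `|rcoord w i - rcoord p i| < e) -> A w.
Proof.
move=> /nbhs_ballP[e /= e0 pA].
have eE : e = (complex.Re e)%:C by rewrite RRe_real// gtr0_real.
have e0' : 0 < complex.Re e by rewrite -ltcR -eE.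
exists (complex.Re e / 2) => [|w pw]; first by rewrite divr_gt0.
apply: pA; split=> // i j; rewrite /ball/= ord1 distrC eE.
apply: le_lt_trans (normc_le_ReIm _) _; rewrite ltcR.
have := pw (j, false); have := pw (j, true); rewrite /rcoord/=.
case: ((w : 'rV_2) 0 j) ((p : 'rV_2) 0 j) => [x y] [x' y'] /= h1 h2.
by rewrite [ltRHS]splitr ltrD.
Qed.

(** A countable basis of C^2, whose images under the open projection form one of the quotient. *)
Definition rat_box (c : {ffun 'I_2 * bool -> rat} * nat) : set (Cn R 2) :=
  [set w | forall i, `|rcoord w i - ratr (c.1 i)| < c.2.+1%:R^-1].

Lemma open_rat_box c : open (rat_box c).
Proof.
rewrite openE => w wc; apply: (@filter_forall _ _ _ _ (nbhs_filter w)) => i.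
have : open [set v : Cn R 2 | `|rcoord v i - ratr (c.1 i)| < c.2.+1%:R^-1].
  exact/open_norm_lt/continuous_rcoord.
by rewrite openE; apply; exact: wc.
Qed.

Lemma rat_box_basis p (A : set (Cn R 2)) : nbhs p A ->
  exists2 c, rat_box c p & rat_box c `<=` A.
Proof.
move=> /nbhs_rcoord[e e0 pA].
(* The radius 1/(n+1) is below e/2, so points of one box differ by less than [e] in each
   coordinate. *)
pose n := Num.truncn (e / 2)^-1.
have n0 : 0 < n.+1%:R^-1 :> R by rewrite invr_gt0 ltr0n.
have ne : n.+1%:R^-1 < e / 2.
  by rewrite -[ltRHS]invrK ltf_pV2 ?posrE ?invr_gt0 ?divr_gt0// truncnS_gt.
have qP (i : 'I_2 * bool) : exists q : rat, `|rcoord p i - ratr q| < n.+1%:R^-1 :> R.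
  have /rat_in_itvoo[q] : rcoord p i < rcoord p i + n.+1%:R^-1 by rewrite ltrDl.
  rewrite in_itv/= => /andP[h1 h2]; exists q.
  by rewrite ltr_distlC h2 (lt_trans _ h1)// ltrBlDr ltrDl.
have [q qp] := choice qP.
exists ([ffun i => q i], n) => [i|w wb]; first by rewrite /= ffunE.
apply: pA => i; have := wb i; rewrite /= ffunE; have := qp i.
move: (_^-1) ne (ratr _) => c ce r.
by rewrite !ltr_norml => /andP[? ?] /andP[? ?]; apply/andP; split; lra.
Qed.

Lemma quot_second_countable : @second_countable (@quot R d).
Proof.
exists (range (fun c => quot_proj d @` rat_box c)).
  exact/(card_le_trans (card_image_le _ _))/countableP.
split=> [_ [c _ <-]|x]; first exact/open_quot_proj/open_rat_box.
have [p <-] := quot_proj_onto x.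
move=> A /(@continuous_quot_proj _ d p) /rat_box_basis[c cp cA].
exists (quot_proj d @` rat_box c) => /=; first by split; [exists c|exists p].
by move=> _ [w wc <-]; exact: cA.
Qed.

Definition quot_surface : complex_surface R.
Proof.
apply: (@ComplexManifold R 2 (@quot R d) quot_hausdorff quot_second_countable (@quot_atlas R d)).
- move=> x; have [p <-] := quot_proj_onto x.
  exists (quot_chart d p); first by exists p.
  by exists p => //; apply: strip_center; rewrite invr_gt0.
- move=> _ _ x [p _ <-] [q _ <-] /= xp xq.
  by apply: differentiable_section_proj; rewrite proj_section.
Defined.

End surface.

(** * Calculus of the function |v|^2 *)

Section calculus_lemmas.
Context {R : realType} {n : nat}.
Implicit Types (w z : Cn R n) (i k : 'I_n * bool) (U : set (Cn R n)).

Lemma rcoord_line z i k (t : R) :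
  rcoord (z + t%:C *: rdir i) k = rcoord z k + t * (k == i)%:R.
Proof.
case: i k => [i bi] [k bk]; rewrite /rcoord /rdir !mxE/= xpair_eqE.
by case: (z 0 k) => x y; case: (k == i); case: bi; case: bk => /=; ring.
Qed.

Global Instance is_derive_rcoord_line z i k (t : R) :
  is_derive t 1 (fun t : R => rcoord (z + t%:C *: rdir i) k) (k == i)%:R.
Proof.
under eq_fun do rewrite rcoord_line.
apply: is_derive_eq.
by rewrite /GRing.scale/=; ring.
Qed.

Lemma pd_cst i (c : R) : pd i (fun _ : Cn R n => c) = fun=> 0.
Proof. by apply/funext => z; rewrite /pd /rline derive1_cst. Qed.

Lemma pd_scale_rcoord i k (c : R) :
  pd i (fun w => c * rcoord w k) = fun=> c * (k == i)%:R.
Proof.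
apply/funext => z; rewrite /pd derive1E; apply: derive_val.
Qed.

Lemma Ck_cst m U (c : R) : Ck m U (fun _ : Cn R n => c).
Proof.
elim: m c => [|m IH] c; split=> //; try by move=> z _; exact: cst_continuous.
move=> i; split; first by move=> z _; exact: derivable_cst.
by rewrite pd_cst; exact: IH.
Qed.

(** The first partial derivatives of |v|^2 have this form. *)
Lemma Ck_scale_rcoord m U k (c : R) : Ck m U (fun w : Cn R n => c * rcoord w k).
Proof.
have cf : continuous (fun w : Cn R n => c * rcoord w k : R).
  move=> z; apply: (@cvgMl_tmp _ _ _ (nbhs_filter z)).
  exact: continuous_rcoord.
case: m => [|m]; split; try by move=> z _; exact: cf.
  by [].
move=> i; split; last by rewrite pd_scale_rcoord; exact: Ck_cst.
move=> z _; exact: ex_derive.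
Qed.

End calculus_lemmas.

Section exhaustion_function.
Context {R : realType}.
Implicit Types (w z : Cn R 2) (i k : 'I_2 * bool) (U : set (Cn R 2)).

Lemma continuous_sum_sqr (T : topologicalType) (f g : T -> R) :
  continuous f -> continuous g -> continuous (fun t => f t ^+ 2 + g t ^+ 2).
Proof.
move=> cf cg t; rewrite /continuous_at; under eq_fun do rewrite !expr2.
by rewrite !expr2; apply: cvgD; apply: cvgM; [exact: cf|exact: cf|exact: cg|exact: cg].
Qed.

Definition sqnorm_snd w : R := rcoord w (1, false) ^+ 2 + rcoord w (1, true) ^+ 2.

Lemma continuous_sqnorm_snd : continuous sqnorm_snd.
Proof.
apply: (@continuous_sum_sqr (Cn R 2) (fun w => rcoord w _) (fun w => rcoord w _));
  exact: continuous_rcoord.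
Qed.

Global Instance is_derive_sqnorm_snd z i :
  is_derive (0 : R) 1 (rline sqnorm_snd z i) ((i.1 == 1)%:R * 2 * rcoord z i).
Proof.
apply: is_derive_eq; rewrite /GRing.scale/= !rcoord_line.
case: i => i b; rewrite !xpair_eqE/=.
have [->|->] := ord2P i.
  by rewrite /=; ring.
by case: b => /=; ring.
Qed.

Lemma pd_sqnorm_snd i :
  pd i sqnorm_snd = fun w => (i.1 == 1)%:R * 2 * rcoord w i.
Proof. by apply/funext => z; rewrite /pd derive1E; apply: derive_val. Qed.

Lemma Ck_sqnorm_snd m U : Ck m U sqnorm_snd.
Proof.
have cf := continuous_sqnorm_snd.
case: m => [|m]; split; try by move=> z _; exact: cf.
  by [].
move=> i; split; last by rewrite pd_sqnorm_snd; exact: Ck_scale_rcoord.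
by move=> z _; exact: ex_derive.
Qed.

Lemma dz_sqnorm_snd z j : dz sqnorm_snd z j = (j == 1)%:R * (snd_co z)^*.
Proof.
rewrite /dz !pd_sqnorm_snd /= /snd_co /rcoord/=.
case: eqVneq => [->|_]; last by rewrite /= !mul0r !mulr0 oppr0.
rewrite /= !mul1r; case: (_ 0 1) => x y /=.
by rewrite !mulrA !mulVf ?pnatr_eq0// !mul1r.
Qed.

Lemma dzdzbar_sqnorm_snd z (j k : 'I_2) :
  dzdzbar sqnorm_snd z j k = ((j == 1) && (k == 1))%:R.
Proof.
rewrite /dzdzbar !pd_sqnorm_snd /= !pd_scale_rcoord !xpair_eqE/= !andbF !andbT.
have [->|->] := ord2P j; have [->|->] := ord2P k; rewrite /= !(mulr0, mul0r, mulr1, mul1r, addr0, subr0)//.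
by congr Complex; field.
Qed.

(** The only nonzero second derivative is the one in the fibre coordinate and its conjugate. The
    form is thus nonnegative and vanishes exactly on horizontal vectors. *)
Lemma levi_form_sqnorm_snd z (v : 'rV_2) :
  levi_form sqnorm_snd z v = v 0 1 * (v 0 1)^*.
Proof.
rewrite /levi_form.
have E (j k : 'I_2) : dzdzbar sqnorm_snd z j k * v 0 j * (v 0 k)^* =
    if j == 1 then (if k == 1 then v 0 1 * (v 0 1)^* else 0) else 0.
  rewrite dzdzbar_sqnorm_snd.
  by case: eqP => [->|_]; case: eqP => [->|_]; rewrite ?mul1r ?mul0r.
have E1 (j : 'I_2) : \sum_(k < 2) dzdzbar sqnorm_snd z j k * v 0 j * (v 0 k)^* =
    if j == 1 then v 0 1 * (v 0 1)^* else 0.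
  under eq_bigr do rewrite E.
  by case: (j == 1) => /=; [rewrite -big_mkcond big_pred1_eq|rewrite big1].
by under eq_bigr do rewrite E1; rewrite -big_mkcond big_pred1_eq.
Qed.

End exhaustion_function.

(** * Real analyticity of |v|^2 *)

Section analyticity.
Context {R : realType}.

Lemma sum_ord_vanishing (f : nat -> R) k N : (forall j, (k <= j)%N -> f j = 0) ->
  (k <= N)%N -> \sum_(j < N) f j = \sum_(j < k) f j.
Proof.
move=> f0 kN; rewrite -!(big_mkord xpredT) (big_cat_nat (n := k))//=.
suff -> : \sum_(k <= i < N) f i = 0 by rewrite addr0.
by rewrite big_nat_cond big1// => j /andP[/andP[kj _] _]; exact: f0.
Qed.

Lemma sum_ord_vanishing_le (f : nat -> R) k N : (forall j, 0 <= f j) ->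
  (forall j, (k <= j)%N -> f j = 0) -> \sum_(j < N) f j <= \sum_(j < k) f j.
Proof.
move=> f0 fk; rewrite -(sum_ord_vanishing fk (leq_addl N k)) big_split_ord/=.
by rewrite lerDl sumr_ge0.
Qed.

(** Distributivity reduces a sum over multi-indices of product terms to sums in one variable
    each. *)
Lemma sum_ffun_prod (I : finType) N (F : I -> nat -> R) :
  \sum_(m : {ffun I -> 'I_N}) \prod_i F i (m i) = \prod_i \sum_(j < N) F i j.
Proof. by rewrite bigA_distr_bigA. Qed.

Context {n : nat}.
Implicit Types (z h : Cn R n) (s i : 'I_n * bool).

(* Coefficients of [(x + h_s)^2] with respect to the variable [h_i]. *)
Definition sqr_coef s (x : R) i : nat -> R :=
  nth 0 (if i == s then [:: x ^+ 2; x *+ 2; 1] else [:: 1]).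

Lemma sqr_coef_vanishing s x i j : (3 <= j)%N -> sqr_coef s x i j = 0.
Proof. by move=> j3; rewrite /sqr_coef nth_default//; case: ifP => _ //; case: j j3. Qed.

Lemma sqr_coef_bound s x N :
  \sum_(m : {ffun 'I_n * bool -> 'I_N}) `|\prod_i sqr_coef s x i (m i)| <=
  \prod_i \sum_(j < 3) `|sqr_coef s x i j|.
Proof.
rewrite (eq_bigr _ (fun m _ => normr_prod _ _ _)).
rewrite (sum_ffun_prod N (fun i j => `|sqr_coef s x i j|)).
apply: ler_prod => i _; rewrite sumr_ge0//=.
apply: (@sum_ord_vanishing_le (fun j => `|sqr_coef s x i j|)) => // j j3.
by rewrite sqr_coef_vanishing// normr0.
Qed.

Lemma sqr_coef_sum s x h N : (3 <= N)%N ->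
  \sum_(m : {ffun 'I_n * bool -> 'I_N})
    (\prod_i sqr_coef s x i (m i)) * \prod_i rcoord h i ^+ m i =
  (x + rcoord h s) ^+ 2.
Proof.
move=> N3; under eq_bigr do rewrite -big_split/=.
rewrite (sum_ffun_prod N (fun i j => sqr_coef s x i j * rcoord h i ^+ j)).
have -> : (x + rcoord h s) ^+ 2 =
    \prod_i (if i == s then (x + rcoord h s) ^+ 2 else 1).
  by rewrite -big_mkcond big_pred1_eq.
apply: eq_bigr => i _.
rewrite (@sum_ord_vanishing (fun j => sqr_coef s x i j * rcoord h i ^+ j) 3)//; last first.
  by move=> j j3; rewrite sqr_coef_vanishing// mul0r.
rewrite /sqr_coef; case: eqP => [->|_]; rewrite !big_ord_recl big_ord0 /=; ring.
Qed.

End analyticity.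

Section exhaustion_analytic.
Context {R : realType}.

Lemma real_analytic_sqnorm_snd (z : Cn R 2) : real_analytic_at sqnorm_snd z.
Proof.
pose s1 : 'I_2 * bool := (1, false); pose s2 : 'I_2 * bool := (1, true).
pose c s (m : {ffun 'I_2 * bool -> nat}) := \prod_i sqr_coef s (rcoord z s) i (m i).
have cE s N (m : {ffun 'I_2 * bool -> 'I_N}) :
    c s [ffun i => m i : nat] = \prod_i sqr_coef s (rcoord z s) i (m i).
  by apply: eq_bigr => i _; rewrite ffunE.
(* The coefficients are those of the polynomial (x + h_s1)^2 + (y + h_s2)^2; being a polynomial, it
   allows any radius, here 1. *)
exists (fun m => c s1 m + c s2 m), 1,
  (\prod_i \sum_(j < 3) `|sqr_coef s1 (rcoord z s1) i j| +
   \prod_i \sum_(j < 3) `|sqr_coef s2 (rcoord z s2) i j|); split=> // [N|h _].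
  apply: le_trans (lerD (sqr_coef_bound s1 _ N) (sqr_coef_bound s2 _ N)).
  rewrite -big_split/=; apply: ler_sum => m _.
  by rewrite expr1n mulr1 !cE ler_normD.
apply: cvg_near_cst.
(* The degree in each variable is at most 2, so the partial sums are exact from [N] = 3 on. *)
exists 3%N => // N /= N3.
under eq_bigr do rewrite !cE mulrDl.
rewrite big_split/= !sqr_coef_sum// /sqnorm_snd /rcoord/= !mxE.
by case: ((z : 'rV_2) 0 1) ((h : 'rV_2) 0 1) => [x y] [x' y'].
Qed.

End exhaustion_analytic.

(** * The exhaustion function on the quotient *)

Section quotient_exhaustion.
Context {R : realType} (d : int).
Implicit Types (a b : int) (w p : Cn R 2).

(** Evaluation at an arbitrary representative, meaningful when [f] is constant on orbits. *)
Definition descend (T : Type) (f : Cn R 2 -> T) (x : @quot R d) : T :=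
  f (xget 0 [set w | quot_proj d w = x]).

Lemma descend_proj (T : Type) (f : Cn R 2 -> T) w :
  (forall a b v, (d %| a)%Z -> f (act a b v) = f v) ->
  descend f (quot_proj d w) = f w.
Proof.
move=> finv; rewrite /descend.
have /= : [set v | quot_proj d v = quot_proj d w]
    (xget 0 [set v | quot_proj d v = quot_proj d w]) by apply: xgetPex; exists w.
by move=> /quot_projP[a [b [da {2}->]]]; rewrite finv.
Qed.

Lemma continuous_descend (T : topologicalType) (f : Cn R 2 -> T) :
  (forall a b v, (d %| a)%Z -> f (act a b v) = f v) ->
  continuous f -> continuous (descend f).
Proof.
move=> finv cf; apply: continuous_quot.
have -> // : descend f \o quot_proj d = f.
by apply/funext => w; exact: descend_proj.
Qed.

Lemma sqnorm_sndE w : (sqnorm_snd w)%:C = `|snd_co w| ^+ 2.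
Proof. exact: add_Re2_Im2. Qed.

Lemma sqnorm_snd_act a b w : sqnorm_snd (act a b w) = sqnorm_snd w.
Proof. by apply: complexI; rewrite !sqnorm_sndE snd_vec normrM norm_cis mul1r. Qed.

Definition height : @quot R d -> R := descend sqnorm_snd.

Lemma height_proj w : height (quot_proj d w) = sqnorm_snd w.
Proof. by apply: descend_proj => a b v _; exact: sqnorm_snd_act. Qed.

Lemma continuous_height : continuous height.
Proof.
apply: continuous_descend; last exact: continuous_sqnorm_snd.
by move=> a b v _; exact: sqnorm_snd_act.
Qed.

Definition real_vec (x : (R * R) * (R * R)) : Cn R 2 :=
  vec (x.1.1 +i* x.1.2) (x.2.1 +i* x.2.2).

Lemma continuous_real_vec : continuous real_vec.
Proof.
apply: continuous_vec; apply: continuous_complex => x;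
  apply: continuous_comp; [exact: cvg_fst|exact: cvg_fst|exact: cvg_fst|exact: cvg_snd
  |exact: cvg_snd|exact: cvg_fst|exact: cvg_snd|exact: cvg_snd].
Qed.

Context (d0 : 0 < d).

Lemma fundamental_domain w : exists a b, (d %| a)%Z /\
  let z := fst_co (act a b w) in
  0 <= complex.Re z <= d%:~R /\ 0 <= complex.Im z <= 1.
Proof.
have d0' : 0 < d%:~R :> R by rewrite ltr0z.
exists (- (Num.floor (complex.Re (fst_co w) / d%:~R) * d)),
  (- Num.floor (complex.Im (fst_co w))).
split; first by rewrite rpredN dvdz_mull.
rewrite fst_vec; case: (fst_co w) => x y /=; rewrite !intrN intrM.
have := floor_itv (x / d%:~R); have := floor_itv y.
rewrite ler_pdivlMr// ltr_pdivrMr// !intrD mulrDl => /andP[? ?] /andP[? ?].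
by split; apply/andP; split; lra.
Qed.

Lemma sqr_le_norm (s c : R) : s ^+ 2 <= c -> `|s| <= c + 1.
Proof.
move=> sc; apply: le_trans (_ : s ^+ 2 + 1 <= _); last by rewrite lerD2r.
rewrite -[s ^+ 2]real_normK ?num_real//.
have := sqr_ge0 (`|s| - 1); have := normr_ge0 s; move: `|s| => t; nra.
Qed.

(** The sublevel set is closed and lies in the image of a compact box: a fundamental domain in the
    base times a square containing the disc |v|^2 <= c. *)
Lemma compact_height_le (c : R) : compact [set x | height x <= c].
Proof.
pose box := (`[0, d%:~R] `*` `[0, 1]) `*` (`[- (c + 1), c + 1] `*` `[- (c + 1), c + 1]) :
  set ((R * R) * (R * R)).
apply: (@subclosed_compact _ _ ((quot_proj d \o real_vec) @` box)).
- have /continuous_closedP hc := continuous_height.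
  exact: (hc [set y : R | y <= c] (@closed_le _ c)).
- apply: continuous_compact.
    apply: continuous_subspaceT => x; apply: continuous_comp.
      exact: continuous_real_vec.
    exact: continuous_quot_proj.
  by do !apply: compact_setX; exact: segment_compact.
move=> x; have [w <-] := quot_proj_onto x; rewrite /= height_proj => wc.
have [a [b [da /= [h1 h2]]]] := fundamental_domain w.
set v := act a b w in h1 h2.
have vw : quot_proj d v = quot_proj d w by apply/esym/quot_projP; exists a, b.
have vc : sqnorm_snd v <= c by rewrite sqnorm_snd_act.
exists ((complex.Re (fst_co v), complex.Im (fst_co v)),
        (complex.Re (snd_co v), complex.Im (snd_co v))); last first.
  rewrite -vw /= /real_vec/=; congr quot_proj.
  by rewrite -[RHS]vec_eta; case: (fst_co v) => ? ?; case: (snd_co v) => ? ?.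
do 2 split=> /=; rewrite in_itv//= -ler_norml; apply: sqr_le_norm;
  apply: le_trans vc; rewrite /sqnorm_snd /rcoord/= ?lerDl ?lerDr ?sqr_ge0//.
Qed.

(** Segments from the origin of C^2 project to connected sets with a common point that cover the
    quotient. *)
Lemma quot_connected : connected [set: @quot R d].
Proof.
pose ray w (t : R) : @quot R d := quot_proj d (vec (t%:C * fst_co w) (t%:C * snd_co w)).
have -> : [set: @quot R d] = \bigcup_(w in [set: Cn R 2]) (ray w @` `[0, 1]).
  apply/seteqP; split=> // x _; have [w <-] := quot_proj_onto x.
  exists w => //; exists 1; first by rewrite /= in_itv/= ler01 lexx.
  by rewrite /ray !mul1r vec_eta.
apply: bigcup_connected => [|w _].
  exists (quot_proj d 0) => w _; exists 0; first by rewrite /= in_itv/= ler01 lexx.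
  by rewrite /ray !mul0r /vec !scale0r addr0.
apply: connected_continuous_connected; first exact: segment_connected.
apply: continuous_subspaceT => t.
apply: (@continuous_comp _ _ _ (fun t : R => vec (t%:C * fst_co w) (t%:C * snd_co w))).
  by apply: continuous_vec => {}t; apply: cvgMr_tmp; exact: continuous_real_complex.
exact: continuous_quot_proj.
Qed.

Lemma quot_not_compact : ~ compact [set: @quot R d].
Proof.
move=> cX.
have [|x _ xmax] := compact_EVT_max _ cX (continuous_subspaceT continuous_height).
  by exists (quot_proj d 0).
(* The point (0, t) has height t^2, which exceeds the supposed maximum [height x]. *)
pose t := height x + 1.
have := xmax (quot_proj d (vec 0 t%:C)) (mem_setT _).
rewrite height_proj /sqnorm_snd /rcoord/= -/(snd_co _) snd_vec /= expr0n addr0.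
by apply/negP; rewrite -ltNge /t; nra.
Qed.

End quotient_exhaustion.

(** * The Levi foliation *)

Section grauert.
Context {R : realType} (d : int).
Context (d0 : 0 < d).
Implicit Types (a b : int) (w p : Cn R 2).
Local Notation X := (@quot_surface R d).

Lemma height_chart (c : chart R 2 X) : @atlas R 2 X c ->
  (@height R d : X -> R) \o chart_inv c = sqnorm_snd.
Proof. by move=> [p _ <-]; apply/funext => w; exact: height_proj. Qed.

Lemma height_smooth : smooth (@height R d : X -> R).
Proof. by move=> c /height_chart -> k; exact: Ck_sqnorm_snd. Qed.

Lemma height_analytic_psh_exhaustion : analytic_psh_exhaustion (@height R d : X -> R).
Proof.
split=> [c x /height_chart -> _|c x /height_chart -> _ v|c].
- exact: real_analytic_sqnorm_snd.
- by rewrite levi_form_sqnorm_snd mulcJ_ge0.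
- exact: compact_height_le.
Qed.

(** All partial derivatives of |v|^2 vanish on the zero section, which is the level 0. *)
Lemma height_regular_neq0 (r : R) : regular_value (@height R d : X -> R) r -> r != 0.
Proof.
move=> reg; apply/eqP => r0.
pose c : chart R 2 X := quot_chart d 0.
have ac : @atlas R 2 X c by exists 0.
have s0 : strip 2^-1 0 (0 : Cn R 2) by apply: strip_center; rewrite invr_gt0.
have c0 : c (quot_proj d 0) = 0 by exact: section_proj.
have [||i] := reg c (quot_proj d 0) ac.
- by exists 0.
- rewrite /level_set/= height_proj r0 /sqnorm_snd /rcoord/= mxE.
  by rewrite expr0n addr0.
- rewrite height_chart// pd_sqnorm_snd c0 /rcoord mxE.
  by case: i.2; rewrite /= mulr0 eqxx.
Qed.

(** Where the fibre coordinate is nonzero, a complex tangent vector of the level is horizontal, and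
    the Levi form vanishes on it. *)
Lemma height_levi_flat (r : R) : r != 0 -> levi_flat_level (@height R d : X -> R) r.
Proof.
move=> r0 c x ac xc xr v; rewrite height_chart// levi_form_sqnorm_snd.
under eq_bigr do rewrite dz_sqnorm_snd -mulrA.
have -> : \sum_(j < 2) ((j == 1)%:R * ((snd_co (c x))^* * v 0 j)) =
    (snd_co (c x))^* * v 0 1 :> R[i].
  by rewrite !big_ord_recl big_ord0 /= mul0r mul1r add0r addr0; congr (_ * v 0 _); exact: val_inj.
move/eqP; rewrite mulf_eq0 conjc_eq0 => /orP[/eqP s0|/eqP ->]; last by rewrite mul0r.
exfalso; move/eqP: r0; apply.
have <- : height x = r := xr.
have /(congr1 (fun f => f (c x))) /= := height_chart ac; rewrite (chart_mapK xc) => ->.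
by apply: complexI; rewrite sqnorm_sndE s0 normr0 expr0n.
Qed.

Lemma is_derive_affine (K : numFieldType) (V : normedModType K) (u v : V) (t : K) :
  is_derive t 1 (fun t : K^o => u + t *: v) v.
Proof.
have dif : is_diff (t : K^o) (cst u + ( *:%R ^~ v)) (0 + ( *:%R ^~ v)).
  exact: is_diffD.
apply: DeriveDef; first by apply: diff_derivable; case: dif.
rewrite deriveE; last by case: dif.
by rewrite diff_val /= add0r scale1r.
Qed.

Lemma horizontal_disc_immersed (r : R) (z l v : R[i]) :
  l != 0 -> sqnorm_snd (vec z v) = r ->
  immersed_disc (level_set (@height R d : X -> R) r)
    (fun t : R[i]^o => quot_proj d (vec (z + t * l) v)).
Proof.
move=> l0 vr t _.
have vecE (x y : R[i]) (s : R[i]^o) :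
    vec (x + s * l) y = vec x y + s *: (l *: delta_mx 0 0 : Cn R 2).
  by rewrite /vec scalerDl scalerA addrAC.
have cv : continuous (fun t : R[i]^o => vec (z + t * l) v).
  move=> s; apply: differentiable_continuous; apply/derivable1_diffP.
  under eq_fun do rewrite vecE.
  by have [] := is_derive_affine (vec z v) (l *: delta_mx 0 0 : Cn R 2) s.
split.
- by apply: (continuous_comp (cv t)); exact: continuous_quot_proj.
- rewrite /level_set/= height_proj -vr; apply: complexI.
  by rewrite !sqnorm_sndE !snd_vec.
(* In a chart the disc coincides near [t] with its image under one [act a b], an affine disc with
   the same nonzero horizontal direction. *)
move=> _ [p _ <-] /= /section_near[a [b [da _ near_act]]].
set f := (f in derivable f _ _).
pose u := vec (z + (a%:~R +i* b%:~R)) (cis a%:~R * v).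
have fE : \forall s \near t, u + s *: (l *: delta_mx 0 0 : Cn R 2) = f s.
  apply: (@filterS _ _ (nbhs_filter t) _ _ _ (cv t _ near_act)) => s; rewrite /f/= => ->.
  by rewrite /act fst_vec snd_vec [z + _ + _]addrAC vecE.
have [df Df] := is_derive_affine u (l *: delta_mx 0 0 : Cn R 2) t.
split; first exact: near_eq_derivable fE df.
rewrite -(near_eq_derive _ fE) ?oner_eq0// Df.
by rewrite scaler_eq0 negb_or l0; apply/eqP => /rowP/(_ 0)/eqP; rewrite !mxE/= oner_eq0.
Qed.

Lemma share_horizontal_disc (r : R) (z z' v : R[i]) : sqnorm_snd (vec z v) = r ->
  share_disc (level_set (@height R d : X -> R) r)
    (quot_proj d (vec z v)) (quot_proj d (vec z' v)).
Proof.
(* The scale [l] exceeds |z' - z|, so one disc centred at [z] reaches [z']. *)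
move=> vr; pose l := `|z' - z| + 1.
have l0 : 0 < l by rewrite ltr_wpDl.
exists (fun t : R[i]^o => quot_proj d (vec (z + t * l) v)); split.
- by apply: horizontal_disc_immersed => //; rewrite gt_eqF.
- by exists 0; rewrite ?mul0r ?addr0// /unit_disc/= normr0.
- exists ((z' - z) / l); last by rewrite divfK ?gt_eqF// addrC subrK.
  by rewrite /unit_disc/= normrM normfV (gtr0_norm l0) ltr_pdivrMr// mul1r ltrDl.
Qed.

Lemma irrational_div_2pi : ~ rational (d%:~R / (pi *+ 2) : R).
Proof.
move=> [q _ qE]; apply: (@pi_irrationnal R).
exists (d%:~R / (q *+ 2)) => //.
have pi0 : (pi : R) != 0 by rewrite gt_eqF// pi_gt0.
have d1 : d%:~R != 0 :> R by rewrite intr_eq0 gt_eqF.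
rewrite fmorph_div rmorphMn rmorph_int/= qE.
move: (pi : R) (d%:~R : R) pi0 d1 => x y x0 y0.
by field; rewrite x0 y0.
Qed.

(** The leaf of [p] contains the projection of the line through [p] with constant fibre coordinate.
    Over the base point of [q] it thus meets the fibre in all the rotations of [snd_co p] by
    multiples of [d], which are dense in the circle through [q]. Density holds in the whole level
    set, hence in each component. *)
Lemma height_dense_leaves (r : R) : r != 0 -> dense_leaves (level_set (@height R d : X -> R) r).
Proof.
move=> r0 x xr y /(@connected_component_sub _ _ _) yr B yB.
have [p pE] := quot_proj_onto x; have [q qE] := quot_proj_onto y.
have pr : sqnorm_snd p = r by rewrite -(height_proj d) pE.
have qr : sqnorm_snd q = r by rewrite -(height_proj d) qE.
have p0 : snd_co p != 0.
  by apply: contra_neq r0 => p0; apply: complexI; rewrite -pr sqnorm_sndE p0 normr0 expr0n.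
have [t tE] : exists t, snd_co q / snd_co p = cis t.
  apply: cis_onto; rewrite normrM normfV; apply/eqP.
  rewrite -(@eqrXn2 _ 2)// ?mulr_ge0 ?invr_ge0// expr1n exprMn exprVn -!sqnorm_sndE.
  by rewrite pr qr mulfV//; apply: contra_neq r0 => /complexI.
pose curve s : X := quot_proj d (vec (fst_co q) (cis s * snd_co p)).
have ccurve : continuous curve.
  move=> s; apply: (@continuous_comp _ _ _ (fun s => vec (fst_co q) (cis s * snd_co p))).
    apply: continuous_vec => {}s; first exact: cvg_cst.
    by apply: cvgMr_tmp; exact: continuous_cis.
  exact: continuous_quot_proj.
have : nbhs (curve t) B by rewrite /curve -tE divfK// vec_eta qE.
move=> /ccurve /nbhs_ballP[e /= e0 eB].
have tau0 : 0 < (pi : R) *+ 2 by rewrite pmulrn_rgt0// pi_gt0.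
(* Angles are measured in full turns: after multiplication by 2 pi, k d + 2 pi m is within [e] of
   [t]. *)
have [k [m km]] := irrational_multiples_dense (t / (pi *+ 2)) irrational_div_2pi
  (divr_gt0 e0 tau0).
exists (curve ((k * d)%:~R + m%:~R * (pi *+ 2))); split; last first.
  apply: eB; rewrite /ball/= distrC -(ltr_pM2r (_ : 0 < (pi *+ 2)^-1)) ?invr_gt0//.
  rewrite -[X in _ * X]gtr0_norm ?invr_gt0// -normrM.
  by rewrite mulrBl mulrDl mulfK ?gt_eqF// intrM -mulrA.
rewrite /curve cisD2pi.
(* Acting by (k d, 0) trades the rotation in the fibre for a translation in the base, which stays on
   the line of [p]. *)
have -> : quot_proj d (vec (fst_co q) (cis (k * d)%:~R * snd_co p)) =
    quot_proj d (vec (fst_co q - (k * d)%:~R) (snd_co p)).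
  apply/esym/quot_projP; exists (k * d), 0; split; first exact: dvdz_mull.
  rewrite /act fst_vec snd_vec; congr vec.
  by rewrite -[_ +i* _]/((k * d)%:~R%:C) rmorph_int subrK.
apply: rt_step; rewrite -pE -[in quot_proj d p](vec_eta p).
by apply: share_horizontal_disc; rewrite vec_eta.
Qed.

Lemma quot_grauert_type : grauert_type X.
Proof.
split; [exact: quot_connected|exact: quot_not_compact|].
exists (@height R d : X -> R); first exact: height_analytic_psh_exhaustion.
move=> r /height_regular_neq0 r0; split; first exact: height_levi_flat.
exact: height_dense_leaves.
Qed.

End grauert.

(** * The double cover *)

Section translations.
Context {R : realType} (d d' : int).
Implicit Types (a b : int) (w p : Cn R 2).
Local Notation X := (@quot_surface R d).
Local Notation Y := (@quot_surface R d').

Lemma near_quot_proj (T : topologicalType) (f : @quot R d -> T) w :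
  {for w, continuous (f \o quot_proj d)} -> {for quot_proj d w, continuous f}.
Proof.
move=> cf A /cf /(@quot_proj_nbhs _ d); apply: filterS => _ [v Av <-]; exact: Av.
Qed.

(** In charts [f] becomes locally an [act a b] followed by the one coming from the section of the
    target, again an [act]. It applies to the involution, the covering and its local inverses. *)
Lemma holomorphic_of_act (U : set X) (f : X -> Y) :
  (forall w, U (quot_proj d w) ->
    exists a b, \forall v \near w, f (quot_proj d v) = quot_proj d' (act a b v)) ->
  holomorphic_on U f.
Proof.
move=> fE x; have [w <-] := quot_proj_onto x => Uw.
split.
  apply: near_quot_proj; have [a [b fw]] := fE w Uw.
  rewrite /prop_for/continuous_at/= (nbhs_singleton fw) => A Aw.
  have := @continuous_quot_proj R d' _ _ Aw; move=> /(@continuous_act _ a b w).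
  by apply: (@filterS2 _ _ (nbhs_filter w) _ _ _ _ fw) => v /= ->.
move=> _ _ [p _ <-] [q _ <-] /= wp fwq.
set v := section p _.
have vE : quot_proj d v = quot_proj d w by exact: proj_section.
rewrite -vE in Uw fwq.
have [a [b fv]] := fE v Uw; rewrite (nbhs_singleton fv) in fwq.
have [a' [b' [_ _ sE]]] := section_near fwq.
apply: near_eq_differentiable (differentiable_act (a' + a) (b' + b) v).
have sE' : \forall u \near v, section q (quot_proj d' (act a b u)) = act a' b' (act a b u).
  exact: (@continuous_act _ a b v) sE.
by apply: (@filterS2 _ _ (nbhs_filter v) _ _ _ _ fv sE') => u /= -> ->; rewrite actA.
Qed.

Context (dd' : (d' %| d)%Z).

(** One construction for both maps: the involution is d = d' = 2, a = 1, and the covering is d = 2,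
    d' = 1, a = 0. It is well defined as Z^2 is commutative and [d'] divides [d]. *)
Definition translation a : X -> Y := @descend R d Y (quot_proj d' \o act a 0).

Lemma translation_proj a w : translation a (quot_proj d w) = quot_proj d' (act a 0 w).
Proof.
apply: descend_proj => a' b' v da'; apply/esym/quot_projP.
exists a', b'; split; first exact: dvdz_trans da'.
by rewrite !actA !addr0 !add0r addrC.
Qed.

Lemma holomorphic_translation a : holomorphic_on [set: X] (translation a).
Proof.
apply: holomorphic_of_act => w _; exists a, 0.
by apply: (@filterE _ _ (nbhs_filter w)) => v; exact: translation_proj.
Qed.

End translations.

Section local_inverse.
Context {R : realType} (d d' : int).

(** Lifting by a section and projecting to the other quotient gives the local inverse of the
    covering. *)
Lemma holomorphic_section_proj (p : Cn R 2) :
  holomorphic_on (quot_proj d' @` strip 2^-1 p : set (@quot_surface R d'))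
    (quot_proj d \o section p : quot_surface d' -> @quot_surface R d).
Proof.
apply: holomorphic_of_act => w /section_near[a [b [_ _ sE]]]; exists a, b.
by apply: (@filterS _ _ (nbhs_filter w) _ _ _ sE) => v /= ->.
Qed.

Context (dd' : (d' %| d)%Z).

Lemma translation_local_biholomorphism : local_biholomorphism (@translation R d d' 0).
Proof.
move=> x; have [p <-] := quot_proj_onto x.
have tE w : @translation R d d' 0 (quot_proj d w) = quot_proj d' w by rewrite translation_proj// act0.
have imE : @translation R d d' 0 @` (quot_proj d @` strip 2^-1 p) = quot_proj d' @` strip 2^-1 p.
  apply/seteqP; split=> [_ [_ [w pw <-] <-]|_ [w pw <-]]; first by exists w.
  by exists (quot_proj d w) => //; exists w.
exists (quot_proj d @` strip 2^-1 p), (quot_proj d \o section p); split.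
- split; first exact/open_quot_proj/open_strip.
  by exists p => //; apply: strip_center; rewrite invr_gt0.
- by rewrite imE; exact/open_quot_proj/open_strip.
- by move=> _ [w pw <-]; rewrite tE /= section_proj.
- by move=> y _; exact: holomorphic_translation.
- by rewrite imE; exact: holomorphic_section_proj.
Qed.

End local_inverse.

Section involution.
Context {R : realType}.
Implicit Types (a b : int) (w : Cn R 2).
Local Notation T := (@translation R 2 2 1).
Local Notation q := (@translation R 2 1 0).

Lemma double_cover_involution : holomorphic_involution T.
Proof.
split; first exact: holomorphic_translation.
move=> x; have [w <-] := quot_proj_onto x; rewrite !translation_proj//.
by apply/esym/quot_projP; exists 2, 0; split=> //; rewrite actA.
Qed.

(** A fixed point would give [act 1 0 w = act a b w] with [a] even, while the first coordinate
    forces [a] = 1. *)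
Lemma double_cover_involution_free x : T x <> x.
Proof.
have [w <-] := quot_proj_onto x; rewrite translation_proj// => /esym/quot_projP[a [b [a2 wE]]].
have : act (- 1 + a) b w = w by rewrite -[RHS](actK 1 0) wE actA oppr0 add0r.
move/(congr1 (fun v => complex.Re (fst_co v))); rewrite /= fst_vec; case: (fst_co w) => x' y' /= xE.
have a1 : - 1 + a = 0 by apply: (@norm_int_lt1 R); rewrite -[X in `|X|](addKr x') xE addNr normr0.
by move: a2; rewrite (_ : a = 1)//; apply/eqP; rewrite -subr_eq0 addrC a1.
Qed.

(** When (a, b) relates two points of C^2, the parity of [a] decides whether they are equal in the
    double cover or exchanged by [T]. *)
Lemma double_cover_quotient : is_quotient_by T q.
Proof.
split.
- move=> y; have [w <-] := quot_proj_onto y.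
  by exists (quot_proj 2 w); rewrite translation_proj// act0.
- move=> x x'; have [w <-] := quot_proj_onto x; have [w' <-] := quot_proj_onto x'.
  rewrite !translation_proj// !act0; split=> [/quot_projP[a [b [_ ->]]]|].
    have [a2|a2] := boolP (2 %| a)%Z; [left|right].
      by apply/esym/quot_projP; exists a, b.
    apply/esym/quot_projP; exists (a - 1), b; split; last by rewrite actA subrK addr0.
    have [r0 r2] : 0 <= (a %% 2)%Z /\ (a %% 2)%Z < 2 by rewrite modz_ge0// ltz_pmod.
    have r1 : (a %% 2)%Z = 1.
      apply/eqP; rewrite eq_le -(ltzD1 _ 1) r2 -gtz0_ge1 lt_neqAle r0 andbT eq_sym.
      by apply: contra a2 => /eqP/dvdz_mod0P.
    by apply/dvdzP; exists (a %/ 2)%Z; rewrite [in LHS](divz_eq a 2) r1 addrK.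
  case=> /esym/quot_projP[a [b [_ wE]]].
    by apply/quot_projP; exists a, b; rewrite dvd1z.
  by apply/quot_projP; exists (a + 1), b; rewrite dvd1z wE actA addr0.
- exact: translation_local_biholomorphism.
Qed.

End involution.

(** * Absence of proper pluriharmonic functions *)

Section second_derivative_test.
Context {R : realType}.

Lemma second_derivative_ge0 (f df : R -> R) : (forall t : R, is_derive t 1 f (df t)) ->
  derivable df 0 1 -> (\forall t \near (0 : R), f 0 <= f t) -> 0 <= derive1 df 0.
Proof.
move=> fdf ddf /nbhs_ballP[e /= e0 fmin].
have df0 : df 0 = 0.
  have min0 : is_derive (0 : R) 1 f 0.
    apply: (@derive1_at_min _ f (- e) e); rewrite ?in_itv/=.
    - by rewrite ge0_cp// ltW.
    - by move=> t _; exact: ex_derive.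
    - by rewrite oppr_lt0 e0.
    - move=> t; rewrite in_itv/= => te; apply: fmin.
      by rewrite /ball/= sub0r normrN ltr_norml.
  by have [_ <-] := fdf 0; have [_ ->] := min0.
(* If the derivative of [df] at 0 were negative, [df] would be negative just to the right of 0, and
   the mean value theorem would give values of [f] below the minimum. *)
rewrite derive1E leNgt; apply/negP => neg.
have : (fun h => h^-1 *: ((df \o shift 0) (h *: 1) - df 0)) @ 0^' --> 'D_1 df 0 by exact: ddf.
move=> /cvgr_lt/(_ _ neg); rewrite /= => /nbhs_ballP[e' /= e'0 quot_lt0].
pose t := Num.min e e' / 2.
have m0 : 0 < Num.min e e' by rewrite lt_min e0.
have t0 : 0 < t by rewrite divr_gt0.
have tm : t < Num.min e e' by rewrite ltr_pdivrMr// mulrC ltr_pMl// ltr1n.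
have [te te'] : t < e /\ t < e' by move: tm; rewrite lt_min => /andP.
have df_lt0 s : 0 < s -> s < e' -> df s < 0.
  move=> s0 se'; have := quot_lt0 s; rewrite /ball/= sub0r normrN gtr0_norm//.
  move=> /(_ se'); rewrite gt_eqF// => /(_ isT).
  by rewrite df0 subr0 addr0 /GRing.scale/= mulr1 pmulr_rlt0// invr_gt0.
have cf : {within `[0, t], continuous f}.
  by apply: derivable_within_continuous => s _; exact: ex_derive.
have [s] := MVT t0 (fun s _ => fdf s) cf.
rewrite in_itv/= => /andP[s0 st] fE.
have : f 0 <= f t by apply: fmin; rewrite /ball/= sub0r normrN gtr0_norm.
rewrite -subr_ge0 fE subr0; apply/negP; rewrite -ltNge.
by rewrite pmulr_llt0// df_lt0// (lt_trans st).
Qed.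

Lemma is_derive_lincomb (f g : R -> R) (c t a b : R) :
  is_derive t 1 f a -> is_derive t 1 g b ->
  is_derive t 1 (fun s => f s + c * g s) (a + c * b).
Proof. by move=> df dg; apply: is_derive_eq; rewrite /GRing.scale/=; ring. Qed.

End second_derivative_test.

Section pd_lemmas.
Context {R : realType} {n : nat}.
Implicit Types (f g : Cn R n -> R) (p : Cn R n) (i : 'I_n * bool).

(** [pd] records the derivative at parameter 0; moving the base point along the line gives it at
    every [t]. *)
Lemma is_derive_rline f p i : (forall z, derivable (rline f z i) 0 1) ->
  forall t : R, is_derive t 1 (rline f p i) (pd i f (p + t%:C *: rdir i)).
Proof.
move=> df t.
have -> : rline f p i = rline f (p + t%:C *: rdir i) i \o shift (- t).
  apply/funext => s; rewrite /rline/= -addrA -scalerDl -rmorphD/=.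
  by rewrite [t + _]addrC subrK.
rewrite -[pd _ _ _]mulr1; apply: is_derive1_comp; last exact: is_derive_shift.
by rewrite /= subrr; apply: DeriveDef; [exact: df|rewrite -derive1E].
Qed.

Lemma pd_lincomb f g (c : R) p i :
  derivable (rline f p i) 0 1 -> derivable (rline g p i) 0 1 ->
  derivable (rline (fun z => f z + c * g z) p i) 0 1 /\
  pd i (fun z => f z + c * g z) p = pd i f p + c * pd i g p.
Proof.
move=> df dg.
have isd h : derivable (rline h p i) 0 1 -> is_derive (0 : R) 1 (rline h p i) (pd i h p).
  by move=> dh; apply: DeriveDef; [exact: dh|rewrite -derive1E].
have dfg : is_derive (0 : R) 1 (rline (fun z => f z + c * g z) p i)
    (pd i f p + c * pd i g p).
  exact: is_derive_lincomb (isd _ df) (isd _ dg).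
split; first by case: dfg.
by rewrite {1}/pd derive1E; case: dfg.
Qed.

Lemma pd_pd_ge0 f p i : (forall z, derivable (rline f z i) 0 1) ->
  derivable (rline (pd i f) p i) 0 1 ->
  (\forall z \near p, f p <= f z) -> 0 <= pd i (pd i f) p.
Proof.
move=> df ddf pmin.
apply: (second_derivative_ge0 (is_derive_rline p df)) => //.
have e0 : p + (0 : R)%:C *: rdir i = p by rewrite scale0r addr0.
have cl : (p + t%:C *: rdir i : Cn R n) @[t --> (0 : R)] --> p.
  rewrite -[X in _ --> X]e0; apply: (@cvgD _ (Cn R n)); first exact: cvg_cst.
  exact: (@cvgZr_tmp _ (Cn R n)) (@continuous_real_complex R 0).
by apply: (@filterS _ _ (nbhs_filter (0 : R)) _ _ _ (cl _ pmin)) => t /=; rewrite /rline e0.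
Qed.

End pd_lemmas.

(** * Minimum principle in the fibre direction *)

Section vertical_harmonicity.
Context {R : realType}.
Implicit Types (f g : Cn R 2 -> R) (p z : Cn R 2).

(** Harmonicity in v alone, with the differentiability that the second derivative test asks for;
    besides continuity, this is what is retained of pluriharmonicity. *)
Definition vertically_harmonic f : Prop :=
  [/\ forall z b, derivable (rline f z (1, b)) 0 1,
      forall z b, derivable (rline (pd (1, b) f) z (1, b)) 0 1 &
      forall z, pd (1, false) (pd (1, false) f) z + pd (1, true) (pd (1, true) f) z = 0].

Lemma vertically_harmonicN f : vertically_harmonic f -> vertically_harmonic (fun z => - f z).
Proof.
move=> [df ddf lap].
have pdN h (b : bool) : (forall z, derivable (rline h z (1, b)) 0 1) ->
    pd (1, b) (fun z => - h z) = fun z => - pd (1, b) h z.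
  by move=> dh; apply/funext => z; rewrite /pd !derive1E -deriveN.
split=> [z b|z b|z].
- exact: derivableN (df z b).
- rewrite pdN//; exact: derivableN (ddf z b).
- by rewrite !pdN// -opprD lap oppr0.
Qed.

Lemma pd_pd_sqnorm_snd b : pd (1, b) (pd (1, b) sqnorm_snd) = fun _ : Cn R 2 => 2.
Proof. by rewrite pd_sqnorm_snd pd_scale_rcoord eqxx /= mul1r mulr1. Qed.

Lemma vertically_harmonic_no_local_min f (c : R) p : 0 < c -> vertically_harmonic f ->
  ~ (\forall z \near p, f p - c * sqnorm_snd p <= f z - c * sqnorm_snd z).
Proof.
move=> c0 [df ddf lap] pmin.
have dS z (i : 'I_2 * bool) : derivable (rline sqnorm_snd z i) 0 1 by exact: ex_derive.
pose g z := f z + - c * sqnorm_snd z.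
have dg b z : derivable (rline g z (1, b)) 0 1 by case: (pd_lincomb (- c) (df z b) (dS z _)).
have pdg b : pd (1, b) g = fun z => pd (1, b) f z + - c * pd (1, b) sqnorm_snd z.
  by apply/funext => z; case: (pd_lincomb (- c) (df z b) (dS z (1, b))).
have ddS z (i : 'I_2 * bool) : derivable (rline (pd i sqnorm_snd) z i) 0 1.
  rewrite pd_sqnorm_snd.
  by case: (@Ck_scale_rcoord R 2 1 setT i ((i.1 == 1)%:R * 2)) => _ /(_ i)[+ _]; apply.
(* At a minimum both second derivatives of [g] are nonnegative, so the Laplacian of [f] in v would
   be at least 4c instead of 0. *)
have ge0 b : 2 * c <= pd (1, b) (pd (1, b) f) p.
  have [ddg pddg] := pd_lincomb (- c) (ddf p b) (ddS p (1, b)).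
  rewrite -pdg in ddg pddg.
  have : 0 <= pd (1, b) (pd (1, b) g) p.
    apply: pd_pd_ge0; [exact: dg|exact: ddg|].
    by apply: (@filterS _ _ (nbhs_filter p) _ _ _ pmin) => z; rewrite /g !mulNr.
  by rewrite pddg pd_pd_sqnorm_snd mulNr subr_ge0 mulrC.
have := ge0 false; have := ge0 true; have := lap p.
by move: (pd _ _ _) (pd _ _ _) => x y; lra.
Qed.

End vertical_harmonicity.

Lemma continuous_sub_scale (R : realType) (T : topologicalType) (f g : T -> R) (c : R) :
  continuous f -> continuous g -> continuous (fun t => f t - c * g t).
Proof.
move=> cf cg t; apply: cvgB; first exact: cf.
by apply: cvgMl_tmp; exact: cg.
Qed.

(** * Pluriharmonic functions on the quotient *)

Section no_proper_pluriharmonic.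
Context {R : realType} (d : int).
Context (d0 : 0 < d).
Local Notation X := (@quot_surface R d).
Implicit Types (u : X -> R).

Lemma pluriharmonic_lift u : pluriharmonic u ->
  continuous u /\ vertically_harmonic (u \o (quot_proj d : Cn R 2 -> X)).
Proof.
move=> plu.
have ac p : @atlas R 2 X (quot_chart d p) by exists p.
have codom p : chart_codom (quot_chart d p : chart R 2 X) p.
  have s0 : strip 2^-1 p p by apply: strip_center; rewrite invr_gt0.
  by exists (quot_proj d p); [exists p|exact: section_proj].
split.
  move=> x; have [p <-] := quot_proj_onto x; apply: near_quot_proj.
  by have [[+ _] _] := plu _ (ac p); apply.
split=> [p b|p b|p].
- by have [[_ /(_ (1, b))[+ _]] _] := plu _ (ac p); apply.
- by have [[_ /(_ (1, b))[_ [_ /(_ (1, b))[+ _]]]] _] := plu _ (ac p); apply.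
- have [_ lap] := plu _ (ac p).
  have [x xp xE] := codom p.
  (* The real part of the entry (1, 1) is a quarter of the Laplacian in v. *)
  have := lap x xp 1 1; rewrite xE /dzdzbar => -[+ _] => /eqP.
  by rewrite mulf_eq0 invr_eq0 pnatr_eq0/= => /eqP.
Qed.

(** The factor 1/c makes the subtracted term equal to 1 on the level [c], so the margin in [m + 1]
    keeps [g] above [m] there. If u(0, 0) <= m, the minimum of [g] is at most [m] and hence
    interior. *)
Lemma level_min_le u (c m : R) : continuous u ->
  vertically_harmonic (u \o (quot_proj d : Cn R 2 -> X)) -> 0 < c ->
  (forall x : X, height x = c -> m + 1 < u x) -> m < u (quot_proj d 0).
Proof.
move=> cu hu c0 uc; rewrite ltNge; apply/negP => um.
pose g (x : X) := u x - c^-1 * height x.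
have cg : continuous g := continuous_sub_scale cu (@continuous_height R d).
have h0 : height (quot_proj d 0 : X) = 0.
  by rewrite height_proj /sqnorm_snd /rcoord/= mxE expr0n addr0.
have [|x] := compact_EVT_min _ (@compact_height_le R d d0 c) (continuous_subspaceT cg).
  by exists (quot_proj d 0); rewrite /= h0 ltW.
have [p <-] := quot_proj_onto x; rewrite inE/= => pc pmin.
have : g (quot_proj d p) <= g (quot_proj d 0) by apply: pmin; rewrite inE/= h0 ltW.
rewrite /g h0 mulr0 subr0 => gp.
move: pc; rewrite le_eqVlt => /orP[/eqP pc|pc].
  by move: gp; rewrite pc mulVf ?gt_eqF//; have := uc _ pc; lra.
apply: (@vertically_harmonic_no_local_min R _ (c^-1)%R p _ hu); first by rewrite invr_gt0.
rewrite height_proj in pc.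
have near_c : \forall z \near p, sqnorm_snd z < c.
  by apply: (@cvgr_lt _ _ _ (nbhs_filter p) sqnorm_snd (sqnorm_snd p)) => //;
    exact: continuous_sqnorm_snd.
apply: (@filterS _ _ (nbhs_filter p) _ _ _ near_c) => z zc.
have := pmin (quot_proj d z); rewrite /g !height_proj; apply.
by rewrite inE/= height_proj ltW.
Qed.

Lemma level_abs_gt u (c m : R) : continuous u -> 0 < c -> 0 <= m ->
  (forall x : X, height x = c -> m < `|u x|) ->
  (forall x : X, height x = c -> m < u x) \/ (forall x : X, height x = c -> m < - u x).
Proof.
move=> cu c0 m0 uc.
(* [P] parametrizes the level set by all pairs (z, t), which shows that it is path connected. *)
pose P (z : R[i]) (t : R) : X := quot_proj d (vec z ((Num.sqrt c)%:C * cis t)).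
have PE x : height x = c -> exists z t, x = P z t.
  have [p <-] := quot_proj_onto x; rewrite height_proj => pc.
  have s0 : Num.sqrt c != 0 by rewrite sqrtr_eq0 -ltNge.
  have s0' : (Num.sqrt c)%:C != 0 by rewrite -[0]/(0%:C) (inj_eq (@complexI R)).
  have [t tE] : exists t, snd_co p / (Num.sqrt c)%:C = cis t.
    apply: cis_onto; apply/eqP; rewrite -(@eqrXn2 _ 2)// expr1n normrM normfV.
    rewrite exprMn exprVn -sqnorm_sndE pc normc_def/= expr0n addr0 sqrtr_sqr.
    by rewrite ger0_norm ?sqrtr_ge0// -rmorphXn sqr_sqrtr ?ltW// mulfV// -[0]/(0%:C)
      (inj_eq (@complexI R)) gt_eqF.
  by exists (fst_co p), t; rewrite /P -tE mulrC divfK// vec_eta.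
have Pc z t : height (P z t) = c.
  rewrite height_proj; apply: complexI; rewrite sqnorm_sndE snd_vec normrM norm_cis mulr1.
  rewrite normc_def/= expr0n addr0 sqrtr_sqr ger0_norm ?sqrtr_ge0//.
  by rewrite -rmorphXn sqr_sqrtr ?ltW.
have cP z t : continuous (fun s : R => P (s%:C * z) (s * t)).
  move=> s; apply: (@continuous_comp _ _ _
    (fun s : R => vec (s%:C * z) ((Num.sqrt c)%:C * cis (s * t)))); last first.
    exact: continuous_quot_proj.
  apply: continuous_vec => {}s; first by apply: cvgMr_tmp; exact: continuous_real_complex.
  apply: cvgMl_tmp; apply: (@continuous_comp _ _ _ (fun s : R => s * t)).
    exact: mulrr_continuous.
  exact: continuous_cis.
have sign (v : X -> R) : continuous v -> (forall x, height x = c -> m < `|v x|) ->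
    m < v (P 0 0) -> forall x, height x = c -> m < v x.
  move=> cv vc v0 x xc; have [z [t xE]] := PE x xc.
  rewrite ltNge; apply/negP => vm.
  have vN : v x < - m by have := vc x xc; rewrite ltrNr ltNge lter_norml; lra.
  (* On the path from [P 0 0] to [x], a change of sign would produce a zero of [v] in the level set,
     where |v| > m >= 0. *)
  pose h s := v (P (s%:C * z) (s * t)).
  have ch : {within `[0, 1], continuous h}.
    apply: continuous_subspaceT => s.
    by apply: (continuous_comp (cP z t s)); exact: cv.
  have h0 : h 0 = v (P 0 0) by rewrite /h rmorph0 !mul0r.
  have h1 : h 1 = v x by rewrite xE /h; congr (v (P _ _)); exact: mul1r.
  have [|s _ hs] := IVT (v := 0) ler01 ch.
    have mN : - m <= 0 by rewrite oppr_le0.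
    have vx := le_trans (ltW vN) mN.
    by rewrite h0 h1 ge_min le_max vx orbT (ltW (le_lt_trans m0 v0)).
  by have := vc _ (Pc (s%:C * z) (s * t)); rewrite -/(h s) hs normr0 ltNge m0.
have := uc _ (Pc 0 0); rewrite real_ltr_normr ?num_real// => /orP[u0|u0]; [left|right].
  exact: sign.
apply: (sign (fun x => - u x)) => // [x|x xc]; first exact: cvgN (cu x).
by rewrite normrN; exact: uc.
Qed.

Lemma proper_pluriharmonic_absurd u : proper_map u -> pluriharmonic u -> False.
Proof.
move=> propu /pluriharmonic_lift[cu hu].
pose m := `|u (quot_proj d 0)|.
have um : compact [set x : X | `|u x| <= m + 1].
  have -> : [set x : X | `|u x| <= m + 1] = u @^-1` `[- (m + 1), m + 1].
    by apply/seteqP; split=> x /=; rewrite in_itv/= ler_norml.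
  exact/propu/segment_compact.
have [|x _ xmax] := compact_EVT_max _ um (continuous_subspaceT (@continuous_height R d)).
  by exists (quot_proj d 0); rewrite /= -/m lerDl.
(* The level [c] is positive and lies above the compact set |u| <= m + 1, on which the height is
   maximal at [x]. *)
pose c := `|height x| + 1.
have c0 : 0 < c by rewrite ltr_wpDl.
have uc (y : X) : height y = c -> m + 1 < `|u y|.
  move=> yc; rewrite ltNge; apply/negP => uy.
  have := xmax y; rewrite inE => /(_ uy); rewrite yc /c; apply/negP.
  by rewrite -ltNge ltr_pwDr// ler_norm.
have [] := level_abs_gt cu c0 _ uc; first by rewrite /m addr_ge0 ?normr_ge0.
- by move/(level_min_le cu hu c0); rewrite /m ltNge ler_norm.
- have cNu : continuous (fun x => - u x) by move=> y; exact: cvgN (cu y).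
  move/(level_min_le cNu (vertically_harmonicN hu) c0); rewrite /m -normrN.
  by rewrite ltNge ler_norm.
Qed.

End no_proper_pluriharmonic.

Theorem theorem4p1 (R : realType) :
  exists Xs : complex_surface R,
    weakly_complete Xs /\
    ((exists alpha : Xs -> R, analytic_psh_exhaustion alpha) /\
     grauert_type Xs) /\
    exists T : Xs -> Xs,
      holomorphic_involution T /\
      (forall x : Xs, T x <> x) /\
      exists (X : complex_surface R) (q : Xs -> X),
        is_quotient_by T q /\
        (grauert_type X /\
         exists alpha : X -> R, analytic_psh_exhaustion alpha) /\
        (forall u : X -> R, proper_map u -> pluriharmonic u ->
           exists b : R, forall x : X, u x = b).
Proof.
have exh2 := @height_analytic_psh_exhaustion R 2 isT.
exists (quot_surface 2); split.
  by exists (@height R 2); case: exh2 => _ ? ?; split=> //; exact: height_smooth.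
split; first by split; [exists (@height R 2)|exact: quot_grauert_type].
exists (@translation R 2 2 1); split; first exact: double_cover_involution.
split; first exact: double_cover_involution_free.
exists (quot_surface 1), (@translation R 2 1 0); split; first exact: double_cover_quotient.
split.
  split; first exact: quot_grauert_type.
  by exists (@height R 1); exact: height_analytic_psh_exhaustion.
(* Constancy holds vacuously: the quotient carries no proper pluriharmonic function at all. *)
move=> u propu plu; case: (@proper_pluriharmonic_absurd R 1 isT u propu plu).
Qed.
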